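(* Let $M$ be a compact complex manifold of complex dimension $n$ and let $(E,h)\to M$ be a holomorphic vector bundle of rank $r$ with a Hermitian metric $h$ which is Bott-Chern nonnegative. Then for all $1\leq i\leq n$ and all $\lambda\in\Gamma(i,r)$, the real $(i,i)$-form $c_{\lambda}(E,h)$ is strongly nonnegative and bounded below and above respectively by $c_i(E,h)$ and $c_1(E,h)^i$: $$0\leq_{\mathrm{s}} c_i(E,h)\leq_{\mathrm{s}} c_{\lambda}(E,h)\leq_{\mathrm{s}} c_1(E,h)^i .$$ Consequently the Chern numbers satisfy $$0\leq c_n[E]\leq c_{\lambda}[E]\leq c_1^n[E],\qquad\forall~\lambda\in\Gamma(n,r).$$
   Context: Curvature and Chern forms: let $\nabla$ be the Chern connection of $(E,h)$ and $R=\nabla^2$ its curvature. For a local frame field $\{e_1,\ldots,e_r\}$ of $E$ write $R(e_1,\ldots,e_r)=(e_1,\ldots,e_r)(\Omega^i_j)$ ($i$ row, $j$ column); $\Omega=(\Omega^i_j)$ is the curvature matrix, whose entries are $2$-forms of type $(1,1)$. The Chern forms $c_i(E,h)$ are the globally defined closed real $(i,i)$-forms given by $\det\big(tI_r+\frac{\sqrt{-1}}{2\pi}(\Omega^i_j)\big)=\sum_{i=0}^{r}c_i(E,h)\,t^{r-i}$, with $c_0(E,h)=1$ and $c_i(E,h)=0$ for $i>r$. Products of forms are wedge products. Bott-Chern nonnegativity: $(E,h)$ is Bott-Chern nonnegative (written $h\geq_{\mathrm{BC}}0$) if for any point of $M$ there exist a unitary frame field around it and a matrix $A$ with $r$ rows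 (and any number of columns, which may depend on the point) whose entries are $(1,0)$-forms, such that the curvature matrix under this unitary frame field satisfies $\Omega=A\wedge\overline{A^t}$. Partitions and Chern numbers: $\Gamma(i,r)$ is the set of $\lambda=(\lambda_1,\ldots,\lambda_i)$ of integers with $r\geq\lambda_1\geq\cdots\geq\lambda_i\geq0$ and $\sum_{j=1}^i\lambda_j=i$. For $\lambda\in\Gamma(i,r)$, $c_{\lambda}(E,h):=\prod_{j=1}^i c_{\lambda_j}(E,h)$. For $\lambda\in\Gamma(n,r)$, the Chern number is $c_{\lambda}[E]:=\int_M\prod_{j=1}^n c_{\lambda_j}(E,h)\in\mathbb{Z}$. Also $c_n[E]:=\int_M c_n(E,h)$ and $c_1^n[E]:=\int_M c_1(E,h)^n$. Strong nonnegativity: a real $(p,p)$-form $\varphi$ on $M$ is strongly nonnegative (written $\varphi\geq_{\mathrm{s}}0$) if at every point it can be written as a finite sum $\varphi=(\sqrt{-1})^{p^2}\sum_i\psi_i\wedge\overline{\psi_i}$, where the $\psi_i$ are $(p,0)$-forms. For two real $(p,p)$-forms, $\varphi_1\leq_{\mathrm{s}}\varphi_2$ means $\varphi_2-\varphi_1\geq_{\mathrm{s}}0$. *)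

(* Defs.v *)
From HB Require Import structures.
From mathcomp Require Import all_boot all_order all_algebra.
From mathcomp Require Import zify.
Set Implicit Arguments. Unset Strict Implicit. Unset Printing Implicit Defensive.
Import Order.TTheory GRing.Theory Num.Theory.
Local Open Scope ring_scope.

(* The exterior algebra on N generators: an element is its family of
   coefficients on the monomials e_S, where e_S is the product of the
   generators indexed by S, in increasing order. *)
Definition ext (K : comNzRingType) (N : nat) := {ffun {set 'I_N} -> K}.

HB.instance Definition _ (K : comNzRingType) (N : nat) :=
  GRing.Lmodule.copy (ext K N) {ffun {set 'I_N} -> K^o}.

Section Ext.
Variables (K : comNzRingType) (N : nat).
Implicit Types (S T U : {set 'I_N}) (f g h : ext K N).

(* e_S * e_T = shuffle_sign S T *: e_(S :|: T) *)
Definition shuffle_sign S T : K :=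
  if [disjoint S & T]
  then (-1) ^+ (\sum_(s in S) \sum_(t in T) (t < s)%N)
  else 0.

Definition wedge f g : ext K N :=
  [ffun U => \sum_S \sum_(T | S :|: T == U) shuffle_sign S T * f S * g T].

Definition ext1 : ext K N := [ffun U => (U == set0)%:R].

Lemma sum_setU_disjoint S T (F : 'I_N -> nat) : [disjoint S & T] ->
  (\sum_(s in S :|: T) F s = \sum_(s in S) F s + \sum_(s in T) F s)%N.
Proof. by move=> dST; rewrite -bigU //=; apply: eq_bigl => s; rewrite inE. Qed.

Lemma shuffle_signA S T U :
  shuffle_sign S T * shuffle_sign (S :|: T) U
  = shuffle_sign T U * shuffle_sign S (T :|: U).
Proof.
rewrite /shuffle_sign -!setI_eq0 setIUl setIUr !setU_eq0 !setI_eq0.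
case dST: [disjoint S & T]; case dTU: [disjoint T & U];
  case dSU: [disjoint S & U]; rewrite /= ?mul0r ?mulr0 //.
rewrite -!exprD; congr (_ ^+ _).
rewrite sum_setU_disjoint //.
rewrite [in RHS](eq_bigr _ (fun s _ => sum_setU_disjoint _ dTU)).
by rewrite big_split /=; lia.
Qed.

Lemma shuffle_sign0l T : shuffle_sign set0 T = 1.
Proof. by rewrite /shuffle_sign -setI_eq0 set0I eqxx big_set0. Qed.

Lemma shuffle_sign0r T : shuffle_sign T set0 = 1.
Proof.
rewrite /shuffle_sign -setI_eq0 setI0 eqxx big1 // => s _.
by rewrite big_set0.
Qed.

Lemma wedgeA : associative wedge.
Proof.
have collapse (P : pred {set 'I_N}) (F : {set 'I_N} -> {set 'I_N} -> {set 'I_N} -> K) :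
    \sum_(W | P W) \sum_T \sum_(V | T :|: V == W) F W T V
    = \sum_T \sum_(V | P (T :|: V)) F (T :|: V) T V.
  rewrite exchange_big /=; apply: eq_bigr => T _.
  rewrite (exchange_big_dep (fun V => P (T :|: V))) /= => [|W V PW /eqP->//].
  apply: eq_bigr => V PV; rewrite (big_pred1 (T :|: V)) // => W /=.
  by rewrite eq_sym; case: eqP => [->|]; rewrite ?andbT ?andbF.
move=> f g h; apply/ffunP => U; rewrite !ffunE.
transitivity (\sum_S \sum_T \sum_(V | S :|: (T :|: V) == U)
   shuffle_sign T V * shuffle_sign S (T :|: V) * (f S * g T * h V)).
  apply: eq_bigr => S _.
  rewrite -(collapse (fun W => S :|: W == U) (fun W T V =>
    shuffle_sign T V * shuffle_sign S W * (f S * g T * h V))).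
  apply: eq_bigr => W _; rewrite ffunE mulr_sumr; apply: eq_bigr => T _.
  rewrite mulr_sumr; apply: eq_bigr => V _.
  by rewrite !mulrA; do 2!congr (_ * _); rewrite mulrAC [_ * shuffle_sign T V]mulrC.
transitivity (\sum_V \sum_(W | W :|: V == U) \sum_S \sum_(T | S :|: T == W)
    shuffle_sign S T * shuffle_sign W V * (f S * g T * h V)); last first.
  rewrite (exchange_big_dep predT) //=; apply: eq_bigr => W _.
  apply: eq_bigr => V _; rewrite ffunE mulr_sumr mulr_suml.
  apply: eq_bigr => S _; rewrite mulr_sumr mulr_suml; apply: eq_bigr => T _.
  by rewrite !mulrA; do 3!congr (_ * _); rewrite mulrC.
transitivity (\sum_V \sum_S \sum_(T | S :|: T :|: V == U)
    shuffle_sign S T * shuffle_sign (S :|: T) V * (f S * g T * h V)).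
  rewrite [RHS]exchange_big /=; apply: eq_bigr => S _.
  rewrite [RHS](exchange_big_dep predT) //=; apply: eq_bigr => T _.
  apply: eq_big => V; first by rewrite setUA.
  by rewrite shuffle_signA.
by apply: eq_bigr => V _; rewrite (collapse (fun W => W :|: V == U)
  (fun W S T => shuffle_sign S T * shuffle_sign W V * (f S * g T * h V))).
Qed.

Lemma wedge1l : left_id ext1 wedge.
Proof.
move=> f; apply/ffunP => U; rewrite ffunE (bigD1 set0) //= [X in _ + X]big1.
  rewrite addr0 (big_pred1 U) => [|T]; last by rewrite set0U.
  by rewrite ffunE eqxx shuffle_sign0l !mul1r.
by move=> S /negPf S0; rewrite big1 // => T _; rewrite ffunE S0 mulr0 mul0r.
Qed.

Lemma wedge1r : right_id ext1 wedge.
Proof.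
move=> f; apply/ffunP => U; rewrite ffunE (bigD1 U) //= [X in _ + X]big1.
  rewrite addr0 (bigD1 set0) ?setU0 //= big1 => [|T /andP[_ /negPf T0]].
    by rewrite addr0 ffunE eqxx shuffle_sign0r mulr1 mul1r.
  by rewrite ffunE T0 mulr0.
move=> S /negPf SU; rewrite big1 // => T; have [->|T0] := eqVneq T set0.
  by rewrite setU0 SU.
by rewrite ffunE (negPf T0) mulr0.
Qed.

Lemma wedgeDl : left_distributive wedge +%R.
Proof.
move=> f g h; apply/ffunP => U; rewrite !ffunE -big_split /=.
apply: eq_bigr => S _; rewrite -big_split /=; apply: eq_bigr => T _.
by rewrite ffunE mulrDr mulrDl.
Qed.

Lemma wedgeDr : right_distributive wedge +%R.
Proof.
move=> f g h; apply/ffunP => U; rewrite !ffunE -big_split /=.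
apply: eq_bigr => S _; rewrite -big_split /=; apply: eq_bigr => T _.
by rewrite ffunE mulrDr.
Qed.

Lemma ext1_neq0 : ext1 != 0.
Proof.
by apply/eqP => /ffunP /(_ set0); rewrite !ffunE eqxx => /eqP; rewrite oner_eq0.
Qed.

HB.instance Definition _ := GRing.Zmodule_isNzRing.Build (ext K N)
  wedgeA wedge1l wedge1r wedgeDl wedgeDr ext1_neq0.

Lemma wedgeZl (c : K) f g : c *: (f * g) = c *: f * g.
Proof.
apply/ffunP => U; rewrite !ffunE [LHS]mulr_sumr; apply: eq_bigr => S _.
rewrite mulr_sumr; apply: eq_bigr => T _; rewrite ffunE !mulrA.
by congr (_ * _ * _); rewrite mulrC.
Qed.

Lemma wedgeZr (c : K) f g : c *: (f * g) = f * (c *: g).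
Proof.
apply/ffunP => U; rewrite !ffunE [LHS]mulr_sumr; apply: eq_bigr => S _.
rewrite mulr_sumr; apply: eq_bigr => T _; rewrite ffunE !mulrA.
by rewrite [in RHS]mulrAC [in RHS]mulrC -!mulrA.
Qed.

HB.instance Definition _ :=
  GRing.Lmodule_isLalgebra.Build K (ext K N) wedgeZl.
HB.instance Definition _ :=
  GRing.Lalgebra_isAlgebra.Build K (ext K N) wedgeZr.

End Ext.

Section ExtGenerators.
Variables (K : comNzRingType) (N : nat).

Definition gen (s : 'I_N) : ext K N := [ffun U => (U == [set s]%SET)%:R].

(* The substitution s |-> L s of 1-forms for the generators; the product over S
   is taken in increasing order. *)
Definition ext_subst (N' : nat) (L : 'I_N -> ext K N') (w : ext K N) : ext K N' :=
  \sum_(S : {set 'I_N}) w S *: \prod_(s in S) L s.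

End ExtGenerators.

From mathcomp Require Import complex.
From mathcomp Require Import all_classical all_reals all_analysis.
Import numFieldNormedType.Exports.
Local Open Scope classical_set_scope.
Local Open Scope ring_scope.
Local Open Scope complex_scope.

(* C^n is identified with R^(n + n): the complex coordinates of v are
   z_a = v_(lshift n a) + i v_(rshift n a). *)

Section Calculus.
Variables (R : realType) (n : nat).
Local Notation C := R[i].
Local Notation V := 'rV[R]_(n + n).
(* gen (lshift n a) stands for dz_a and gen (rshift n a) for its conjugate *)
Local Notation form := (ext C (n + n)).

Definition zcoord (a : 'I_n) (v : V) : C :=
  v ord0 (lshift n a) +i* v ord0 (rshift n a).

Definition dz (a : 'I_n) : form := gen C (lshift n a).
Definition dzbar (a : 'I_n) : form := gen C (rshift n a).

Definition partial (s : 'I_(n + n)) (f : V -> R) (v : V) : R :=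
  'D_(delta_mx ord0 s) (f : V -> R^o) v.

Fixpoint Ck (k : nat) (O : set V) (f : V -> R) : Prop :=
  (forall v, O v -> {for v, continuous f}) /\
  match k with
  | 0 => True
  | k'.+1 => forall s : 'I_(n + n),
      (forall v, O v -> derivable (f : V -> R^o) v (delta_mx ord0 s)) /\
      Ck k' O (partial s f)
  end.

Definition smooth (O : set V) (f : V -> R) : Prop := forall k, Ck k O f.

Definition smoothC (O : set V) (f : V -> C) : Prop :=
  smooth O (fun v => complex.Re (f v)) /\ smooth O (fun v => complex.Im (f v)).

Definition partialC (s : 'I_(n + n)) (f : V -> C) (v : V) : C :=
  partial s (fun w => complex.Re (f w)) v +i* partial s (fun w => complex.Im (f w)) v.

Definition d_dz (a : 'I_n) (f : V -> C) (v : V) : C :=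
  (partialC (lshift n a) f v - 'i%C * partialC (rshift n a) f v) / 2%:R.
Definition d_dzbar (a : 'I_n) (f : V -> C) (v : V) : C :=
  (partialC (lshift n a) f v + 'i%C * partialC (rshift n a) f v) / 2%:R.

Definition holomorphic (O : set V) (f : V -> C) : Prop :=
  smoothC O f /\ forall (a : 'I_n) v, O v -> d_dzbar a f v = 0.

Definition del (w : V -> form) (v : V) : form :=
  \sum_(a < n) dz a * [ffun S => d_dz a (fun u => w u S) v].
Definition delbar (w : V -> form) (v : V) : form :=
  \sum_(a < n) dzbar a * [ffun S => d_dzbar a (fun u => w u S) v].
Definition dext (w : V -> form) (v : V) : form := del w v + delbar w v.

Definition conj_form (w : form) : form :=
  ext_subst (fun s => match fintype.split s with inl a => dzbar a | inr a => dz a end)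
    ([ffun S => ((w S)^*)%C] : form).

Definition pullback (tau : V -> V) (v : V) (w : form) : form :=
  ext_subst (fun s => match fintype.split s with
    | inl a => dext (fun u => (zcoord a (tau u))%:A) v
    | inr a => dext (fun u => ((zcoord a (tau u))^*)%C%:A) v
    end) w.

Definition bidegree (p q : nat) (w : form) : Prop :=
  forall S : {set 'I_(n + n)}, w S != 0 ->
    #|[set a : 'I_n | lshift n a \in S]%SET| = p /\
    #|[set a : 'I_n | rshift n a \in S]%SET| = q.

Definition strongly_nonneg (p : nat) (w : form) : Prop :=
  exists (m : nat) (psi : 'I_m -> form),
    (forall j, bidegree p 0 (psi j)) /\
    w = 'i%C ^+ (p ^ 2) *: \sum_(j < m) psi j * conj_form (psi j).

(* The volume form dx_1 dy_1 ... dx_n dy_n, with dx_a dy_a = (i/2) dz_a dzbar_a *)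
Definition volume_form : form :=
  \prod_(a < n) (('i%C / 2%:R) *: (dz a * dzbar a)).

Definition density (w : form) : C := w [set: _]%SET / volume_form [set: _]%SET.

Definition scalar_forms p q (A : 'M[C]_(p, q)) : 'M[form]_(p, q) :=
  map_mx (fun c => c%:A) A.
Definition del_mx p q (A : V -> 'M[form]_(p, q)) (v : V) : 'M[form]_(p, q) :=
  \matrix_(a, b) del (fun u => A u a b) v.
Definition dext_mx p q (A : V -> 'M[form]_(p, q)) (v : V) : 'M[form]_(p, q) :=
  \matrix_(a, b) dext (fun u => A u a b) v.
Definition conj_mx p q (A : 'M[form]_(p, q)) : 'M[form]_(p, q) :=
  map_mx conj_form A.

Lemma ext_scalarE (c : C) (S : {set 'I_(n + n)}) :
  (c%:A : form) S = c *+ (S == finset.set0).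
Proof. by rewrite ffunE ffunE; case: eqP => _; rewrite -?mulr1n; [exact: mulr1|exact: mulr0]. Qed.

Lemma partialC0 s v : partialC s (fun _ : V => 0 : C) v = 0.
Proof. by rewrite /partialC /partial /= derive_cst. Qed.

Lemma d_dz_scalar (a : 'I_n) (f : V -> C) v :
  [ffun S => d_dz a (fun u => ((f u)%:A : form) S) v] = (d_dz a f v)%:A :> form.
Proof.
apply/ffunP => S; rewrite ffunE ext_scalarE.
under eq_fun do rewrite ext_scalarE.
by case: eqP => //= _; rewrite /d_dz !partialC0 mulr0 subr0 mul0r.
Qed.

Lemma d_dzbar_scalar (a : 'I_n) (f : V -> C) v :
  [ffun S => d_dzbar a (fun u => ((f u)%:A : form) S) v] = (d_dzbar a f v)%:A :> form.
Proof.
apply/ffunP => S; rewrite ffunE ext_scalarE.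
under eq_fun do rewrite ext_scalarE.
by case: eqP => //= _; rewrite /d_dzbar !partialC0 mulr0 addr0 mul0r.
Qed.

Lemma del_scalar (f : V -> C) v :
  del (fun u => (f u)%:A) v = \sum_a d_dz a f v *: dz a.
Proof. by apply: eq_bigr => a _; rewrite d_dz_scalar -scalerAr mulr1. Qed.

Lemma delbar_scalar (f : V -> C) v :
  delbar (fun u => (f u)%:A) v = \sum_a d_dzbar a f v *: dzbar a.
Proof. by apply: eq_bigr => a _; rewrite d_dzbar_scalar -scalerAr mulr1. Qed.

Lemma conj_formD (w1 w2 : form) : conj_form (w1 + w2) = conj_form w1 + conj_form w2.
Proof.
rewrite /conj_form /ext_subst -big_split; apply: eq_bigr => S _ /=.
by rewrite !ffunE rmorphD scalerDl.
Qed.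

Lemma conj_formZ (c : C) (w : form) : conj_form (c *: w) = c^* *: conj_form w.
Proof.
rewrite /conj_form /ext_subst scaler_sumr; apply: eq_bigr => S _ /=.
by rewrite !ffunE scalerA -rmorphM.
Qed.

Lemma conj_form_sum (I : finType) (F : I -> form) :
  conj_form (\sum_i F i) = \sum_i conj_form (F i).
Proof.
apply: (big_morph (conj_form) conj_formD).
by have := conj_formZ 0 0; rewrite !scale0r rmorph0 scale0r.
Qed.

Lemma conj_form_dz (a : 'I_n) : conj_form (dz a) = dzbar a.
Proof.
rewrite /conj_form /ext_subst (bigD1 [set lshift n a]%SET) //= [X in _ + X]big1.
  rewrite addr0 !ffunE eqxx rmorph1 scale1r.
  rewrite (big_pred1 (lshift n a)) => [|s]; last by rewrite !inE.
  by rewrite (unsplitK (inl a)).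
by move=> S /negPf aS; rewrite !ffunE aS rmorph0 scale0r.
Qed.

Lemma dz_bidegree (a : 'I_n) : bidegree 1 0 (dz a).
Proof.
move=> S; rewrite ffunE; have [->|] := eqVneq S; last by rewrite eqxx.
move=> _.
split.
  rewrite -(cards1 a); apply: eq_card => b; rewrite !inE.
  by apply/eqP/eqP => [/lshift_inj|->].
apply: eq_card0 => b; rewrite !inE; apply/eqP => /(congr1 (@fintype.split n n)).
by rewrite (unsplitK (inr b)) (unsplitK (inl a)).
Qed.

Lemma bidegree_sumZ p q (I : finType) (c : I -> C) (F : I -> form) :
  (forall i, bidegree p q (F i)) -> bidegree p q (\sum_i c i *: F i).
Proof.
move=> HF S; rewrite sum_ffunE => S_neq0.
have [i /(HF i S)//] : exists i, F i S != 0.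
apply/existsP; move: S_neq0; apply: contra_neqT => /existsPn HF0.
rewrite big1 // => i _; rewrite ffunE.
by have := HF0 i; rewrite negbK => /eqP ->; exact: mulr0.
Qed.

Lemma conj_d_dz (O : set V) (a : 'I_n) (f : V -> C) v : smoothC O f -> O v ->
  (d_dz a f v)^* = d_dzbar a (fun u => (f u)^*) v.
Proof.
move=> [_ /(_ 1%N)[_ fI]] Ov.
have pC s : partialC s (fun u => (f u)^*) v = (partialC s f v)^*.
  rewrite /partialC /partial.
  have -> : (fun w => complex.Im ((f w)^*)%C) = - (fun w => complex.Im (f w)) :> (V -> R^o).
    by apply/funext => w; rewrite fctE; case: (f w).
  have reE : (fun w => complex.Re ((f w)^*)%C) = (fun w => complex.Re (f w)) :> (V -> R^o).
    by apply/funext => w; case: (f w).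
  rewrite [in LHS]reE.
  by rewrite deriveN //; exact: (fI s).1.
rewrite /d_dz /d_dzbar !pC rmorphM rmorphB rmorphM fmorphV rmorph_nat.
have iE : (('i%C)^*)%C = - 'i%C :> C by apply/eqP; rewrite eq_complex /= oppr0 !eqxx.
rewrite -mulNr; congr ((_ + _ * _) / _).
by apply: (etrans (congr1 -%R iE)); rewrite opprK.
Qed.

End Calculus.

(* Iterated Lebesgue integral over R^m.  It is only used for continuous functions
   with compact support, for which it is the integral against the product
   measure. *)
Fixpoint integral_rV (R : realType) (m : nat) : ('rV[R]_m -> R) -> R :=
  match m with
  | 0 => fun f => f 0
  | m'.+1 => fun f => Rintegral (@lebesgue_measure R) setT (fun x : R =>
      integral_rV (fun v : 'rV[R]_m' => f (row_mx (const_mx x : 'rV[R]_1) v)))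
  end.

(* Second countability is not required: it is automatic when M is compact. *)
Record complex_manifold (R : realType) (n : nat) (M : topologicalType) := {
  manifold_hausdorff : hausdorff_space M;
  chart : Type;
  cdom : chart -> set M;
  phi : chart -> M -> 'rV[R]_(n + n);
  psi : chart -> 'rV[R]_(n + n) -> M;
  cdom_open : forall i, open (cdom i);
  cdom_cover : forall x, exists i, cdom i x;
  phi_open : forall i, open (phi i @` cdom i);
  phiK : forall i x, cdom i x -> psi i (phi i x) = x;
  phi_continuous : forall i x, cdom i x -> {for x, continuous (phi i)};
  psi_continuous : forall i v, (phi i @` cdom i) v -> {for v, continuous (psi i)};
  transition_holomorphic : forall i j (a : 'I_n),
    holomorphic (phi i @` (cdom i `&` cdom j))
      (fun v => zcoord a (phi j (psi i v)))
}.

Section Manifold.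
Variables (R : realType) (n : nat) (M : topologicalType).
Variable X : complex_manifold R n M.
Local Notation C := R[i].
Local Notation V := 'rV[R]_(n + n).
Local Notation form := (ext C (n + n)).

(* The expressions of a differential form in the charts, at the coordinates v *)
Definition local_forms := chart X -> V -> form.

Definition smooth_form (W : set M) (p q : nat) (w : local_forms) : Prop :=
  [/\ forall (i : chart X) S, smoothC (phi i @` (W `&` cdom i)) (fun v => w i v S),
      forall (i : chart X) x, W x -> cdom i x -> bidegree p q (w i (phi i x)) &
      forall (i j : chart X) x, W x -> cdom i x -> cdom j x ->
        w i (phi i x)
        = pullback (fun v => phi j (psi i v)) (phi i x) (w j (phi j x))].

Definition le_strong (p : nat) (w1 w2 : local_forms) : Prop :=
  forall (i : chart X) x, cdom i x ->
    strongly_nonneg p (w2 i (phi i x) - w1 i (phi i x)).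

Record partition_of_unity := {
  pu_size : nat;
  pu_chart : 'I_pu_size -> chart X;
  pu_fun : 'I_pu_size -> M -> R;
  pu_smooth : forall k (i : chart X),
    smooth (phi i @` cdom i) (fun v => pu_fun k (psi i v));
  pu_ge0 : forall k x, 0 <= pu_fun k x;
  pu_support : forall k,
    closure [set x | pu_fun k x != 0] `<=` cdom (pu_chart k);
  pu_sum1 : forall x, \sum_k pu_fun k x = 1
}.

(* The integral of an (n,n)-form over M.  Its value does not depend on P; the
   function integrated over R^(n + n) is supported in the image of the chart. *)
Definition integral_form (P : partition_of_unity) (w : local_forms) : C :=
  \sum_(k < pu_size P)
    let i := pu_chart k in
    let f v : C := if v \in phi i @` cdom i
                   then (pu_fun k (psi i v))%:C * density (w i v) else 0 in
    integral_rV (fun v => complex.Re (f v)) +i* integral_rV (fun v => complex.Im (f v)).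

End Manifold.

(* triv k x, for x in tdom k, is the fibre at x of the local trivialization
   indexed by k, with inverse untriv k x.  The trivialization triv_at x is one
   chosen around x; nothing below depends on that choice. *)
Record holo_bundle (R : realType) (n : nat) (M : topologicalType)
    (X : complex_manifold R n M) (r : nat) := {
  fib : M -> lmodType R[i];
  tindex : Type;
  tdom : tindex -> set M;
  triv : tindex -> forall x, fib x -> 'cV[R[i]]_r;
  untriv : tindex -> forall x, 'cV[R[i]]_r -> fib x;
  triv_at : M -> tindex;
  tdom_open : forall k, open (tdom k);
  triv_atP : forall x, tdom (triv_at x) x;
  triv_linear : forall k x, tdom k x -> linear (@triv k x);
  trivK : forall k x, tdom k x -> cancel (@triv k x) (@untriv k x);
  untrivK : forall k x, tdom k x -> cancel (@untriv k x) (@triv k x);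
  triv_holomorphic : forall k l, exists g : M -> 'M[R[i]]_r,
    (forall x, tdom k x -> tdom l x ->
       forall u, @triv l x u = g x *m @triv k x u) /\
    (forall (i : chart X) a b,
       holomorphic (phi i @` (cdom i `&` (tdom k `&` tdom l)))
         (fun v => g (psi i v) a b))
}.

Section Bundle.
Variables (R : realType) (n : nat) (M : topologicalType).
Variables (X : complex_manifold R n M) (r : nat) (E : holo_bundle X r).
Local Notation C := R[i].
Local Notation V := 'rV[R]_(n + n).
Local Notation form := (ext C (n + n)).

Definition frame := forall x : M, 'I_r -> fib E x.

(* The holomorphic frame of a local trivialization *)
Definition holo_frame (k : tindex E) : frame :=
  fun x a => untriv k x (delta_mx a ord0).

Definition frame_coord (k : tindex E) (e : frame) (x : M) : 'M[C]_r :=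
  \matrix_(a, b) triv k (e x b) a ord0.

Definition smooth_frame (W : set M) (e : frame) : Prop :=
  forall (i : chart X) (k : tindex E) a b,
    smoothC (phi i @` (W `&` (cdom i `&` tdom k)))
      (fun v => frame_coord k e (psi i v) a b).

Record hermitian_metric := {
  hmet : forall x, fib E x -> fib E x -> C;
  hmet_linear : forall x (c : C) (u v w : fib E x),
    hmet (c *: u + v) w = c * hmet u w + hmet v w;
  hmet_conj : forall x (u v : fib E x), hmet v u = ((hmet u v)^*)%C;
  hmet_gt0 : forall x (u : fib E x), u != 0 -> 0 < hmet u u;
  hmet_smooth : forall (i : chart X) (k : tindex E) a b,
    smoothC (phi i @` (cdom i `&` tdom k))
      (fun v => hmet (holo_frame k (psi i v) a) (holo_frame k (psi i v) b))
}.

Variable h : hermitian_metric.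

(* Orthonormality makes e x a basis of the fibre, which has dimension r. *)
Definition unitary_frame (W : set M) (e : frame) : Prop :=
  smooth_frame W e /\
  forall x, W x -> forall a b, hmet h (e x a) (e x b) = (a == b)%:R.

Definition gram (k : tindex E) (x : M) : 'M[C]_r :=
  \matrix_(a, b) hmet h (holo_frame k x a) (holo_frame k x b).

Lemma hmet0 x (w : fib E x) : hmet h 0 w = 0.
Proof. by have := hmet_linear h (-1) 0 0 w; rewrite scaler0 addr0 mulN1r addNr. Qed.

Lemma gram_unit (k : tindex E) x : tdom k x -> gram k x \in unitmx.
Proof.
move=> kx; have [//|] := boolP (_ \in unitmx).
rewrite unitmxE unitfE negbK => /det0P[c c_neq0 cG].
pose u : fib E x := \sum_a c ord0 a *: holo_frame k x a.
have hl (w : fib E x) : hmet h u w = \sum_a c ord0 a * hmet h (holo_frame k x a) w.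
  apply: (big_ind2 (fun y z => hmet h y w = z)) => [|y1 z1 y2 z2 <- <-|a _].
  - exact: hmet0.
  - by have := hmet_linear h 1 y1 y2 w; rewrite scale1r mul1r.
  - by have := hmet_linear h (c ord0 a) (holo_frame k x a) 0 w;
      rewrite addr0 hmet0 addr0.
have hu a : hmet h u (holo_frame k x a) = 0.
  move/matrixP: cG => /(_ ord0 a); rewrite !mxE => cGa; rewrite hl -[RHS]cGa.
  by apply: eq_bigr => b _; rewrite mxE.
have u0 : u = 0.
  apply/eqP; apply: contraT => /(hmet_gt0 h); rewrite {1}hl big1 ?ltxx // => a _.
  by rewrite hmet_conj hu rmorph0 mulr0.
case/eqP: c_neq0; have tl := triv_linear kx.
have t0 : triv k (0 : fib E x) = 0.
  by have := tl (-1) 0 0; rewrite scaler0 addr0 scaleN1r addNr.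
have tu : triv k u = \sum_a c ord0 a *: triv k (holo_frame k x a).
  apply: (big_ind2 (fun y z => triv k y = z)) => [//|y1 z1 y2 z2 <- <-|a _].
  - by have := tl 1 y1 y2; rewrite !scale1r.
  - by have := tl (c ord0 a) (holo_frame k x a) 0; rewrite addr0 t0 addr0.
apply/rowP => a; move: tu; rewrite u0 t0 => /colP /(_ a).
rewrite summxE (bigD1 a) //= big1 => [|b ba]; rewrite mxE.
  by rewrite addr0 mxE untrivK // mxE !eqxx mulr1 => <-; rewrite mxE.
by rewrite untrivK // mxE eq_sym (negPf ba) mulr0.
Qed.

(* The matrix theta of the Chern connection, nabla s = s theta, in the
   holomorphic frame s of the trivialization k, in the chart i: the matrix of
   (1,0)-forms with d H = theta^T H + H conj(theta), see chern_connectionP. *)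
Definition chern_connection (i : chart X) (k : tindex E) (v : V) : 'M[form]_r :=
  scalar_forms n (invmx (gram k (psi i v))^T)
  *m del_mx (fun u => scalar_forms n (gram k (psi i u))^T) v.

Lemma chern_connectionP (i : chart X) (k : tindex E) v :
  (phi i @` (cdom i `&` tdom k)) v ->
  let H u := scalar_forms n (gram k (psi i u)) in
  let theta := chern_connection i k v in
  (forall a b, bidegree 1 0 (theta a b)) /\
  dext_mx H v = theta^T *m H v + H v *m conj_mx theta.
Proof.
move=> Ov; set O := (phi i @` _) in Ov.
have kx : tdom k (psi i v).
  by case: Ov => x [ix kx] <-; rewrite phiK.
pose G u := gram k (psi i u); rewrite /= -/(G v).
pose f a b u := G u a b.
have fE a b : f a b = fun u => hmet h (holo_frame k (psi i u) a) (holo_frame k (psi i u) b).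
  by apply/funext => u; rewrite /f mxE.
have fsm a b : smoothC O (f a b) by rewrite fE; exact: hmet_smooth.
have fC a b : (fun u => ((f a b u)^*)%C) = f b a.
  by rewrite !fE; apply/funext => u; rewrite -hmet_conj.
have Gu : G v \in unitmx := gram_unit kx.
pose D e : 'M[C]_r := \matrix_(a, b) d_dz e (f a b) v.
pose Db e : 'M[C]_r := \matrix_(a, b) d_dzbar e (f a b) v.
have thetaE : chern_connection i k v
    = \matrix_(a, b) \sum_e ((invmx (G v)^T *m (D e)^T) a b) *: dz R e.
  apply/matrixP => a b; rewrite !mxE.
  under [RHS]eq_bigr do rewrite mxE scaler_suml.
  rewrite exchange_big /=; apply: eq_bigr => c _; rewrite !mxE.
  have -> : (fun u => (scalar_forms n (gram k (psi i u))^T) c b)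
      = (fun u => (f b c u)%:A) by apply/funext => u; rewrite /f /G !mxE.
  rewrite del_scalar mulr_sumr; apply: eq_bigr => e _.
  by rewrite -scalerAl mul1r scalerA !mxE.
split=> [a b|].
  by rewrite thetaE mxE; apply: bidegree_sumZ => e; exact: dz_bidegree.
have mulE1 (A B : 'M[C]_r) a b (w : form) :
   \sum_c (A a c *: w) * (B c b)%:A = (A *m B) a b *: w.
  rewrite mxE scaler_suml; apply: eq_bigr => c _.
  by rewrite -scalerAr mulr1 scalerA mulrC.
have mulE2 (A B : 'M[C]_r) a b (w : form) :
   \sum_c (A a c)%:A * (B c b *: w) = (A *m B) a b *: w.
  rewrite mxE scaler_suml; apply: eq_bigr => c _.
  by rewrite -scalerAl mul1r scalerA.
have SE (A : 'M[C]_r) p q : scalar_forms n A p q = (A p q)%:A by rewrite mxE.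
have CE (A : 'M[form]_r) p q : conj_mx A p q = conj_form (A p q) by rewrite mxE.
have E1 e p q : (invmx (G v)^T *m (D e)^T) p q = (D e *m invmx (G v)) q p.
  by rewrite -trmx_inv -trmx_mul mxE.
apply/matrixP => a b; rewrite thetaE [LHS]mxE [RHS]mxE /dext; congr (_ + _).
  have -> : (fun u => scalar_forms n (gram k (psi i u)) a b)
      = (fun u => (f a b u)%:A) by apply/funext => u; rewrite /f /G !mxE.
  rewrite (del_scalar (f a b)) mxE.
  under [RHS]eq_bigr do rewrite mxE [X in X * _]mxE SE mulr_suml.
  rewrite exchange_big /=; apply: eq_bigr => e _.
  have -> : d_dz e (f a b) v = (D e *m invmx (G v) *m G v) a b.
    by rewrite mulmxKV // mxE.
  by rewrite -mulE1; apply: eq_bigr => c _; rewrite E1.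
have -> : (fun u => scalar_forms n (gram k (psi i u)) a b)
    = (fun u => (f a b u)%:A) by apply/funext => u; rewrite /f /G !mxE.
rewrite (delbar_scalar (f a b)) mxE.
under [RHS]eq_bigr do rewrite SE CE [X in _ * conj_form X]mxE conj_form_sum mulr_sumr.
rewrite exchange_big /=; apply: eq_bigr => e _.
have -> : d_dzbar e (f a b) v = (G v *m (invmx (G v) *m Db e)) a b.
  by rewrite mulKVmx // mxE.
rewrite -mulE2; apply: eq_bigr => c _; rewrite [in RHS]conj_formZ conj_form_dz.
congr (_ * (_ *: _)).
have -> : invmx (G v) = map_mx (@conjc R) (invmx (G v)^T).
  rewrite map_invmx; congr invmx; apply/matrixP => p q.
  by rewrite !mxE; exact: hmet_conj.
have -> : Db e = map_mx (@conjc R) (D e)^T.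
  by apply/matrixP => p q; rewrite !mxE (conj_d_dz e (fsm q p) Ov) fC.
by rewrite -map_mxM [LHS]mxE.
Qed.

(* nabla on m-tuples of E-valued forms s sigma, sigma being the matrix of their
   components in the holomorphic frame s *)
Definition nabla (i : chart X) (k : tindex E) m
    (sigma : V -> 'M[form]_(r, m)) (v : V) : 'M[form]_(r, m) :=
  dext_mx sigma v + chern_connection i k v *m sigma v.

(* Omega, with nabla (nabla e) = e Omega *)
Definition curvature_matrix (e : frame) (i : chart X) (v : V) : 'M[form]_r :=
  let k := triv_at E (psi i v) in
  let g u := frame_coord k e (psi i u) in
  scalar_forms n (invmx (g v))
  *m nabla i k (nabla i k (fun u => scalar_forms n (g u))) v.

(* The Chern forms, computed at each point in a holomorphic frame around it *)
Definition chern_form (p : nat) : local_forms X := fun i v =>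
  let Omega := curvature_matrix (holo_frame (triv_at E (psi i v))) i v in
  if (p <= r)%N then
    (\det ('X%:M + map_mx (fun w => (('i%C / (2%:R * pi%:C)) *: w)%:P) Omega))`_(r - p)
  else 0.

Definition chern_monomial (lam : seq nat) : local_forms X := fun i v =>
  \prod_(p <- lam) chern_form p i v.

Definition bott_chern_nonneg : Prop :=
  forall x : M, exists (W : set M) (e : frame) (m : nat)
      (A : chart X -> V -> 'M[form]_(r, m)),
    [/\ open W, W x, unitary_frame W e,
        forall a b, smooth_form W 1 0 (fun i v => A i v a b) &
        forall (i : chart X) y, W y -> cdom i y ->
          curvature_matrix e i (phi i y)
          = A i (phi i y) *m (conj_mx (A i (phi i y)))^T].

Definition chern_number (P : partition_of_unity X) (lam : seq nat) : C :=
  integral_form P (chern_monomial lam).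

End Bundle.

Definition Gamma (i r : nat) (lam : seq nat) : Prop :=
  [/\ size lam = i, sorted geq lam, all (fun p => p <= r)%N lam & sumn lam = i].

(* Main.v *)
Require Import Defs.
From HB Require Import structures.
From mathcomp Require Import all_boot all_order all_algebra all_fingroup.
From mathcomp Require Import zify.
Set Implicit Arguments. Unset Strict Implicit. Unset Printing Implicit Defensive.
Import Order.TTheory GRing.Theory Num.Theory.
Local Open Scope ring_scope.

(** All the inequalities between forms are pointwise and come from one argument about
orthogonal projections. Write the curvature in a unitary frame as A conj(A)^T, and
for index maps a : [p] -> [r] and k : [p] -> [m] put
T(a, k) = A_(a 1, k 1) ... A_(a p, k p). The p-th Chern form is 1/p! times the sum
over a of the minors det (Omega_(a i, a j)), up to the factor (i / 2 pi)^p
([coef_det_char]). Since the entries of A anticommute, expanding the minors gives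
    c_p = i^(p^2) (2 pi)^-p sum_(a, k) T(a, k) conj (P T)(a, k),
where P averages over all permutations of the p entries of k. A product c_p c_q has
the same expression in degree p + q, with the average taken over the permutations
that preserve the first p positions, because a product of two minors is the minor
of a block diagonal matrix ([sum_det_selectM]). Averages over subgroups are
self-adjoint idempotents, and the smaller subgroup has the larger image; so both P
and the difference of two such averages are projections Q, for which
sum T conj (Q T) = sum (Q T) conj (Q T) is visibly strongly nonnegative
([weighted_trace_gram]). This gives 0 <= c_p and c_(p+q) <= c_p c_q. Strong
nonnegativity is stable under products ([strongly_nonnegM]), and an induction on
the parts of the partition gives c_p <= c_lambda <= c_1^p.

The Chern forms are computed from the curvature in a holomorphic frame and the
Bott-Chern condition bears on a unitary one. Because d d = 0, that is, because
second derivatives commute ([deriveC]), the square of a connection is linear over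
functions ([covariant_square]), so the two curvature matrices are conjugate by an
invertible matrix of functions and have the same characteristic coefficients
([chern_form_unitary]). Forms of even degree commute, which is what gives a meaning
to these determinants: they are computed in the commutative ring [even_form].

For the Chern numbers, a strongly nonnegative form of top degree has a nonnegative
density ([density_ge0]). Near each point the Chern forms are polynomials in the
entries of the smooth matrix A and of its conjugate, so the functions integrated in
the charts are continuous with compact support, and on such functions the iterated
integral is monotone ([le_integral_rV]). *)

(** * Products of anticommuting elements *)

Lemma mulr_signCA (A : nzRingType) n (x y : A) :
  x * ((-1) ^+ n * y) = (-1) ^+ n * (x * y).
Proof. by rewrite !mulrA commr_sign. Qed.

(** Moving the factor of index i to the front crosses the i factors before it. *)
Lemma prod_anticomm_front (A : nzRingType) p (f : 'I_p.+1 -> A) (i : 'I_p.+1) :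
    (forall i j, i != j -> f i * f j = - (f j * f i)) ->
  \prod_j f j = (-1) ^+ i * (f i * \prod_(j < p) f (lift i j)).
Proof.
elim: p f i => [|p IHp] f i f_ac.
  by rewrite ord1 big_ord_recl expr0 mul1r.
case: (unliftP ord0 i) => [k ->|->]; last first.
  by rewrite [LHS]big_ord_recl expr0 mul1r.
rewrite [LHS]big_ord_recl (IHp (fun j => f (lift ord0 j)) k); last first.
  by move=> a b ab; apply: f_ac; rewrite (inj_eq lift_inj).
rewrite [in RHS]big_ord_recl /=.
have -> : lift (lift ord0 k) ord0 = ord0 :> 'I_p.+2 by apply: val_inj.
rewrite mulr_signCA /bump /= add1n exprS mulN1r mulNr -mulrN.
congr (_ * _); rewrite mulrA f_ac ?neq_lift // mulNr -mulrA; congr (- (_ * (_ * _))).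
apply: eq_bigr => j _; congr f; apply: val_inj => /=.
by rewrite /bump /=; lia.
Qed.

(** Induction on p: s sends 0 to some i and induces a permutation of the other
    positions, and the sign of s splits accordingly ([odd_lift_perm]). *)
Lemma prod_anticomm_perm (A : nzRingType) p (f : 'I_p -> A) (s : 'S_p) :
    (forall i j, i != j -> f i * f j = - (f j * f i)) ->
  \prod_j f (s j) = (-1) ^+ s * \prod_j f j.
Proof.
elim: p f s => [|p IHp] f s f_ac; first by rewrite !big_ord0 (permS0 s) odd_perm1 mul1r.
have [i [t ->]] : exists i t, s = lift_perm ord0 i t.
  pose u k := odflt k (unlift (s ord0) (s (lift ord0 k))).
  have uE k : lift (s ord0) (u k) = s (lift ord0 k).
    have : s ord0 != s (lift ord0 k) by rewrite (inj_eq perm_inj) neq_lift.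
    by rewrite /u => /unlift_some[] ? ? ->.
  have u_inj : injective u.
    by move=> a b ab; apply: (@lift_inj _ ord0); apply: (@perm_inj _ s); rewrite -!uE ab.
  exists (s ord0), (perm u_inj); apply/permP => k.
  by case: (unliftP ord0 k) => [k' ->|->]; rewrite ?lift_perm_id // lift_perm_lift permE uE.
rewrite [LHS]big_ord_recl lift_perm_id (prod_anticomm_front i f_ac) odd_lift_perm /=.
under eq_bigr do rewrite lift_perm_lift.
rewrite (IHp (fun j => f (lift i j))) => [|a b ab]; last first.
  by apply: f_ac; rewrite (inj_eq lift_inj).
rewrite mulr_signCA !mulrA; congr (_ * _ * _).
by rewrite -[(-1) ^+ i]signr_odd -signr_addb addbAC addbb.
Qed.

(** Sorting f_1 g_1 ... f_p g_p into the f's followed by the g's makes each g_i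
    cross the f_j with j > i, which is one crossing for each pair. *)
Lemma prod_anticomm_pairs (A : nzRingType) p (f g : 'I_p -> A) :
    (forall i j, g i * f j = - (f j * g i)) ->
  \prod_j (f j * g j) = (-1) ^+ 'C(p, 2) * (\prod_j f j * \prod_j g j).
Proof.
move=> gf.
elim: p f g gf => [|p IHp] f g gf; first by rewrite !big_ord0 !mul1r.
rewrite !big_ord_recl IHp //.
have gP i q (k : 'I_q -> 'I_p.+1) : g i * \prod_j f (k j) = (-1) ^+ q * (\prod_j f (k j) * g i).
  elim: q k => [|q IHq] k; first by rewrite !big_ord0 !mul1r mulr1.
  have /= IHk := IHq (fun j => k (lift ord0 j)).
  rewrite !big_ord_recl mulrA gf mulNr -[_ * g i * _]mulrA IHk exprS mulN1r mulNr.
  by rewrite mulr_signCA -!mulrA.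
rewrite mulr_signCA binS bin1 exprD -!mulrA; congr (_ * _).
have /= gP0 := gP ord0 p (lift ord0).
by rewrite [g ord0 * (\prod_j _ * _)]mulrA gP0 -!mulrA mulr_signCA.
Qed.

(** * The exterior algebra *)

Section ExteriorBasis.
Variables (K : comNzRingType) (N : nat).
Implicit Types (S T U : {set 'I_N}) (f g : ext K N).

Definition monomial S : ext K N := [ffun U => (U == S)%:R].

Lemma ext_monomialE f : f = \sum_S f S *: monomial S.
Proof.
apply/ffunP => U; rewrite sum_ffunE (bigD1 U) //= big1 => [|S SU].
  by rewrite !ffunE eqxx addr0; apply/esym/mulr1.
by rewrite !ffunE eq_sym (negPf SU); exact: mulr0.
Qed.

Lemma monomialM S T :
  monomial S * monomial T = shuffle_sign K S T *: monomial (S :|: T).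
Proof.
apply/ffunP => U; rewrite !ffunE (bigD1 S) //= [X in _ + X]big1 ?addr0; last first.
  by move=> S' /negPf nS; rewrite big1 // => T' _; rewrite !ffunE nS mulr0 mul0r.
rewrite big_mkcond (bigD1 T) //= big1 ?addr0; last first.
  by move=> T' /negPf nT; rewrite !ffunE nT mulr0; case: ifP.
rewrite !ffunE !eqxx !mulr1 eq_sym; case: eqP => _; first exact/esym/mulr1.
exact/esym/mulr0.
Qed.

Lemma extM_monomialE f g :
  f * g = \sum_S \sum_T (f S * g T * shuffle_sign K S T) *: monomial (S :|: T).
Proof.
rewrite {1}(ext_monomialE f) {1}(ext_monomialE g) mulr_suml.
apply: eq_bigr => S _; rewrite mulr_sumr; apply: eq_bigr => T _.
by rewrite -scalerAr -scalerAl monomialM !scalerA [g T * _]mulrC.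
Qed.

Lemma extM_support f g U : (f * g) U != 0 ->
  exists S T, [/\ f S != 0, g T != 0, [disjoint S & T] & U = S :|: T].
Proof.
move=> fgU; have : exists S, [exists T, [&& f S != 0, g T != 0, [disjoint S & T] & U == S :|: T]].
  apply/existsP; apply: contra_neqT fgU; rewrite negb_exists => /forallP fg0.
  rewrite ffunE big1 // => S _; rewrite big1 // => T STU.
  have := fg0 S; rewrite negb_exists => /forallP /(_ T).
  rewrite [U == _]eq_sym STU andbT /shuffle_sign; case: eqP => [->|_] /=; first by rewrite mulr0 mul0r.
  by case: eqP => [->|_]; rewrite ?mulr0 //= => /negPf->; rewrite !mul0r.
by case=> S /existsP[T /and4P[fS gT dST /eqP ->]]; exists S, T.
Qed.

(** For disjoint S and T, each pair in S x T is an inversion for exactly one of the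
    two orders. *)
Lemma shuffle_signC S T :
  shuffle_sign K S T = (-1) ^+ (#|S| * #|T|) * shuffle_sign K T S.
Proof.
rewrite /shuffle_sign disjoint_sym; case: ifP => dTS; last by rewrite mulr0.
rewrite -exprD -sum1_card big_distrl /= -signr_odd -[RHS]signr_odd; congr (_ ^+ _).
have -> : (\sum_(i in S) 1 * #|T| = \sum_(s in S) (\sum_(t in T) (t < s) + \sum_(t in T) (s < t)))%N.
  apply: eq_bigr => s sS; rewrite mul1n -sum1_card -big_split /=.
  apply: eq_bigr => t tT; case: ltngtP => // /val_inj ts.
  by move/pred0P: dTS => /(_ s); rewrite /= sS -ts tT.
rewrite big_split /= [in X in (_ + X + _)%N]exchange_big /= -addnA addnn.
by rewrite oddD odd_double addbF.
Qed.

(** Parity is all that commutation depends on; the zero form has both parities. *)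
Definition has_parity (b : bool) f := [forall S, (f S != 0) ==> (odd #|S| == b)].

Lemma has_parityP b f :
  reflect (forall S, f S != 0 -> odd #|S| = b) (has_parity b f).
Proof.
apply: (iffP forallP) => [fb S fS|fb S]; first by move/implyP: (fb S) => /(_ fS)/eqP.
by apply/implyP => /fb ->.
Qed.

Lemma has_parityM b c f g :
  has_parity b f -> has_parity c g -> has_parity (b (+) c) (f * g).
Proof.
move=> /has_parityP fb /has_parityP gc; apply/has_parityP => U.
case/extM_support => S [T [fS gT dST ->]].
by rewrite cardsU disjoint_setI0 // cards0 subn0 oddD (fb S) // (gc T).
Qed.

Lemma has_parityD b f g :
  has_parity b f -> has_parity b g -> has_parity b (f + g).
Proof.
move=> /has_parityP fb /has_parityP gb; apply/has_parityP => U.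
rewrite ffunE; have [fU|/fb//] := eqVneq (f U) 0.
by rewrite fU add0r => /gb.
Qed.

Lemma has_parity0 b : has_parity b 0.
Proof. by apply/has_parityP => U; rewrite ffunE eqxx. Qed.

Lemma has_parityZ b a f : has_parity b f -> has_parity b (a *: f).
Proof.
move=> /has_parityP fb; apply/has_parityP => U; rewrite ffunE.
have [fU0|/fb //] := eqVneq (f U) 0; rewrite fU0.
by rewrite (_ : _ *: 0 = 0) ?eqxx //; exact: mulr0.
Qed.

Lemma has_parity1 : has_parity false 1.
Proof.
by apply/has_parityP => U; rewrite ffunE; have [->|] := eqVneq U set0; rewrite ?cards0 ?eqxx.
Qed.

Lemma ext_signr (k : nat) f : (-1) ^+ k * f = (-1) ^+ k *: f.
Proof.
rewrite -signr_odd -[in RHS]signr_odd; case: (odd k).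
  by rewrite !expr1 mulN1r scaleN1r.
by rewrite !expr0 mul1r scale1r.
Qed.

Lemma ext_supercomm b c f g : has_parity b f -> has_parity c g ->
  f * g = (-1) ^+ (b && c) * (g * f).
Proof.
move=> /has_parityP fb /has_parityP gc.
rewrite ext_signr !extM_monomialE exchange_big scaler_sumr; apply: eq_bigr => T _.
rewrite scaler_sumr; apply: eq_bigr => S _; rewrite scalerA setUC shuffle_signC.
have [->|fS] := eqVneq (f S) 0; first by rewrite !(mul0r, mulr0).
have [->|gT] := eqVneq (g T) 0; first by rewrite !(mul0r, mulr0).
rewrite -signr_odd oddM (fb S) // (gc T) //; congr (_ *: _).
by rewrite mulrCA [f S * _]mulrC.
Qed.

End ExteriorBasis.

Section Substitution.
Variables (K : comNzRingType) (N N' : nat) (L : 'I_N -> ext K N').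
Hypothesis L_anticomm : forall s t, L s * L t = - (L t * L s).
Hypothesis L_sqr0 : forall s, L s * L s = 0.
Implicit Types (S T : {set 'I_N}) (f g : ext K N).

(** A product over a set is taken in increasing order, so its least element comes
    first. The products over a set are handled through this decomposition. *)
Lemma prod_set_min (s : 'I_N) T : s \notin T -> (forall t, t \in T -> (s < t)%N) ->
  \prod_(t in s |: T) L t = L s * \prod_(t in T) L t.
Proof.
move=> sT s_min; rewrite -[LHS]big_filter -[in RHS]big_filter.
pose lt (i j : 'I_N) := (i < j)%N.
have lt_tr : transitive lt by move=> i j k; apply: ltn_trans.
have sorted_set (A : {set 'I_N}) : sorted lt [seq i <- index_enum 'I_N | i \in A].
  apply: (sorted_filter lt_tr); rewrite [index_enum _]unlock -enumT.
  by have := iota_ltn_sorted 0 N; rewrite -val_enum_ord sorted_map.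
suff -> : [seq i <- index_enum 'I_N | i \in s |: T]
    = s :: [seq i <- index_enum 'I_N | i \in T] by rewrite big_cons.
apply: (irr_sorted_eq lt_tr) => [i|||t]; [by rewrite /lt ltnn|exact: sorted_set| |].
  rewrite /= (path_sortedE lt_tr) sorted_set andbT; apply/allP => t.
  by rewrite mem_filter => /andP[/s_min].
by rewrite inE !mem_filter !mem_index_enum !andbT !inE.
Qed.

Lemma set_min_split T : T != set0 ->
  exists s T', [/\ s \notin T', T = s |: T' & forall t, t \in T' -> (s < t)%N].
Proof.
case/set0Pn => s0 s0T; case: (arg_minnP (fun i : 'I_N => i : nat) s0T) => s sT s_min.
exists s, (T :\ s); split=> [||t]; first by rewrite !inE eqxx.
  by rewrite setD1K.
by rewrite !inE => /andP[ts /s_min]; rewrite leq_eqVlt eq_sym (inj_eq val_inj) (negPf ts).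
Qed.

Lemma shuffle_sign_min (s : 'I_N) T : s \notin T -> (forall t, t \in T -> (s < t)%N) ->
  shuffle_sign K [set s] T = 1.
Proof.
move=> sT s_min; rewrite /shuffle_sign disjoints1 sT big_set1 big1 // => t /s_min.
by case: ltngtP.
Qed.

(** The factor L s crosses the elements of T smaller than s, one at a time; when
    s is already in T it meets a second L s and the product vanishes. *)
Lemma mul_prod_set s T :
  L s * \prod_(t in T) L t = shuffle_sign K [set s] T *: \prod_(t in s |: T) L t.
Proof.
have [k] := ubnP #|T|; elim: k => // k IHk in T *; rewrite ltnS => Tk.
have [->|/set_min_split[t [T' [tT' TE t_min]]]] := eqVneq T set0.
  by rewrite big_set0 shuffle_sign0r setU0 big_set1 mulr1 scale1r.
have T'k : (#|T'| < k)%N by rewrite TE cardsU1 tT' in Tk.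
have PT : \prod_(u in T) L u = L t * \prod_(u in T') L u.
  by rewrite TE prod_set_min.
rewrite PT mulrA; case: (ltngtP s t) => [st|ts|/val_inj st].
- have s_min u : u \in T -> (s < u)%N.
    by rewrite TE !inE => /orP[/eqP->//|/t_min]; exact: ltn_trans.
  have sT : s \notin T by apply/negP => /s_min; rewrite ltnn.
  by rewrite shuffle_sign_min // scale1r prod_set_min // PT mulrA.
- rewrite L_anticomm mulNr -mulrA IHk // -scalerAr.
  have [sT'|sT'] := boolP (s \in T').
    have sT : s \in T by rewrite TE !inE sT' orbT.
    by rewrite /shuffle_sign !disjoints1 sT' sT !scale0r oppr0.
  have st : s != t by apply: contraTneq ts => ->; rewrite ltnn.
  rewrite TE setUCA [in RHS]prod_set_min; first last.
  + by move=> u; rewrite !inE => /orP[/eqP->//|/t_min].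
  + by rewrite !inE negb_or eq_sym st.
  rewrite -scaleNr; congr (_ *: _).
  rewrite /shuffle_sign !disjoints1 !inE negb_or st sT' /= !big_set1.
  by rewrite big_setU1 //= ts exprD expr1 mulN1r.
- rewrite -st L_sqr0 mul0r /shuffle_sign disjoints1 TE st !inE eqxx /=.
  by rewrite scale0r.
Qed.

(** The elements of S are inserted into T from the largest to the smallest; the
    signs accumulate to the shuffle sign by its cocycle identity [shuffle_signA]. *)
Lemma prod_setM S T :
  \prod_(s in S) L s * \prod_(t in T) L t
  = shuffle_sign K S T *: \prod_(s in S :|: T) L s.
Proof.
have [k] := ubnP #|S|; elim: k => // k IHk in S *; rewrite ltnS => Sk.
have [->|/set_min_split[s [S' [sS' SE s_min]]]] := eqVneq S set0.
  by rewrite big_set0 shuffle_sign0l set0U mul1r scale1r.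
have S'k : (#|S'| < k)%N by rewrite SE cardsU1 sS' in Sk.
have -> : \prod_(u in S) L u = L s * \prod_(u in S') L u.
  by rewrite SE prod_set_min.
rewrite -mulrA IHk // -scalerAr mul_prod_set scalerA.
by rewrite -shuffle_signA shuffle_sign_min // mul1r setUA -SE.
Qed.

(** The universal property of the exterior algebra: substituting 1-forms that
    anticommute and square to zero for the generators is multiplicative. *)
Lemma ext_substM f g : ext_subst L (f * g) = ext_subst L f * ext_subst L g.
Proof.
rewrite /ext_subst [RHS]mulr_suml.
transitivity (\sum_S \sum_T (f S * g T * shuffle_sign K S T) *: \prod_(s in S :|: T) L s).
  under eq_bigr do rewrite ffunE scaler_suml.
  rewrite exchange_big /=; apply: eq_bigr => S _.
  under eq_bigr do rewrite scaler_suml.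
  rewrite (exchange_big_dep predT) //=; apply: eq_bigr => T _.
  rewrite (big_pred1 (S :|: T)) => [|U]; last by rewrite /= eq_sym.
  by congr (_ *: _); rewrite -mulrA mulrC.
apply: eq_bigr => S _; rewrite mulr_sumr; apply: eq_bigr => T _.
by rewrite -scalerAr -scalerAl prod_setM !scalerA [g T * _]mulrC.
Qed.

End Substitution.

(** * Principal minors *)

Section PrincipalMinors.
Variable A : comNzRingType.

(** Sylvester's identity: both sides are the determinant of the same block matrix,
    factored in two ways. *)
Lemma det_add1_mulC m n (U : 'M[A]_(m, n)) (V : 'M[A]_(n, m)) :
  \det (1%:M + U *m V) = \det (1%:M + V *m U).
Proof.
have <- : \det (block_mx 1%:M (- U) V 1%:M) = \det (1%:M + U *m V).
  have -> : block_mx 1%:M (- U) V 1%:M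
      = block_mx (1%:M + U *m V) (- U) 0 1%:M *m block_mx 1%:M 0 V 1%:M.
    rewrite mulmx_block !(mulmx1, mul1mx, mulmx0, mul0mx, addr0, add0r) mulNmx.
    by rewrite addrK.
  by rewrite det_mulmx det_ublock det_lblock !det1 !mulr1.
have -> : block_mx 1%:M (- U) V 1%:M
    = block_mx 1%:M 0 V 1%:M *m block_mx 1%:M (- U) 0 (1%:M + V *m U).
  rewrite mulmx_block !(mulmx1, mul1mx, mulmx0, mul0mx, addr0, add0r) mulmxN.
  by rewrite addrCA addNr addr0.
by rewrite det_mulmx det_lblock det_ublock !det1 !mul1r.
Qed.

(** The rows outside I are those of the identity matrix, so the determinant is the
    principal minor on I, without a reindexing of I. *)
Definition mask_rows r (I : {set 'I_r}) (M : 'M[A]_r) : 'M[A]_r :=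
  \matrix_(i, j) if i \in I then M i j else (i == j)%:R.

(** When a is injective this is a principal submatrix, up to the order of its
    rows; letting a range over all maps makes sums of minors multiplicative. *)
Definition select r p (a : {ffun 'I_p -> 'I_r}) (M : 'M[A]_r) : 'M[A]_p :=
  \matrix_(i, j) M (a i) (a j).

(** If N is the matrix of a, then N^T N is the projection onto the image of a and
    N N^T = 1; the masked matrix is 1 + N^T N (M - 1), and Sylvester's identity
    moves its determinant to size p. *)
Lemma det_mask_rows r p (a : {ffun 'I_p -> 'I_r}) (M : 'M[A]_r) : injective a ->
  \det (mask_rows (a @: setT) M) = \det (select a M).
Proof.
move=> a_inj; pose N : 'M[A]_(p, r) := \matrix_(i, j) (a i == j)%:R.
have NM q (B : 'M[A]_(r, q)) i j : (N *m B) i j = B (a i) j.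
  rewrite mxE (bigD1 (a i)) //= mxE eqxx mul1r big1 ?addr0 // => k /negPf ak.
  by rewrite mxE eq_sym ak mul0r.
have MNt q (B : 'M[A]_(q, r)) i j : (B *m N^T) i j = B i (a j).
  rewrite -[B]trmxK -trmx_mul mxE NM; by rewrite !mxE.
have -> : mask_rows (a @: setT) M = 1%:M + N^T *m (N *m (M - 1%:M)).
  apply/matrixP => i j; rewrite mulmxA !mxE.
  (* N^T N is the diagonal matrix of the indicator of the image of a. *)
  have NtN k : (N^T *m N) i k = ((i \in a @: setT) && (i == k))%:R.
    rewrite mxE; case: imsetP => [[l _ ->]|ai] /=; last first.
      rewrite big1 // => l _; rewrite !mxE [a l == i]eq_sym; case: eqP => [il|_]; last by rewrite mul0r.
      by case: ai; exists l; rewrite ?inE.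
    rewrite (bigD1 l) //= !mxE eqxx mul1r big1 ?addr0 // => l' ll'.
    by rewrite !mxE (inj_eq a_inj) (negPf ll') mul0r.
  rewrite (bigD1 i) //= big1 ?addr0 => [|k ki]; last first.
    by rewrite NtN [i == k]eq_sym (negPf ki) andbF mul0r.
  rewrite NtN eqxx andbT !mxE; case: ifP => _; rewrite ?mul0r ?addr0 //.
  by rewrite mul1r addrC subrK.
rewrite det_add1_mulC; congr (\det _); apply/matrixP => i j.
by rewrite -mulmxA mxE NM MNt !mxE (inj_eq a_inj) addrC subrK.
Qed.

Lemma det_select_eq0 r p (a : {ffun 'I_p -> 'I_r}) (M : 'M[A]_r) :
  ~~ injectiveb a -> \det (select a M) = 0.
Proof.
case/injectivePn => i [j ij aij]; apply: (determinant_alternate ij) => k.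
by rewrite !mxE aij.
Qed.

(** A map that is not injective repeats a row, and each set of p indices is the
    image of p! injective maps. *)
Lemma sum_det_select r p (M : 'M[A]_r) :
  \sum_(a : {ffun 'I_p -> 'I_r}) \det (select a M)
  = (\sum_(I : {set 'I_r} | #|I| == p) \det (mask_rows I M)) *+ p`!.
Proof.
rewrite (bigID (fun a : {ffun 'I_p -> 'I_r} => injectiveb a)) /= [X in _ + X]big1; last first.
  by move=> a /det_select_eq0.
rewrite addr0 (partition_big (fun a : {ffun 'I_p -> 'I_r} => a @: setT)
  (fun I => #|I| == p)) /= => [|a /injectiveP a_inj]; last first.
  by rewrite card_imset // cardsT card_ord.
rewrite -sumrMnl; apply: eq_bigr => I /eqP Ip.
rewrite (eq_bigr (fun=> \det (mask_rows I M))) => [|a /andP[/injectiveP a_inj /eqP <-]]; last first.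
  by rewrite det_mask_rows.
rewrite sumr_const; congr (_ *+ _).
rewrite -ffactnn -[X in X ^_ _]Ip -[X in _ ^_ X](card_ord p) -card_inj_ffuns_on.
apply: eq_card => a; rewrite !inE /= [LHS]unfold_in andbC; apply: andb_id2r => /injectiveP a_inj.
apply/eqP/ffun_onP => [<- i|aI]; first by apply: imset_f; rewrite inE.
apply/eqP; rewrite eqEcard card_imset // cardsT card_ord Ip leqnn andbT.
by apply/subsetP => _ /imsetP[i _ ->].
Qed.

(** Expanding every row as the sum of a row of X and a row of M. *)
Lemma det_char_masks r (M : 'M[A]_r) :
  \det ('X%:M + map_mx polyC M)
  = \sum_(I : {set 'I_r}) (\det (mask_rows I M))%:P * 'X^(r - #|I|).
Proof.
rewrite /determinant.
under eq_bigr do under eq_bigr do rewrite !mxE addrC.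
under eq_bigr do rewrite bigA_distr mulr_sumr.
rewrite exchange_big /=; apply: eq_bigr => I _.
rewrite rmorph_sum mulr_suml; apply: eq_bigr => s _ /=.
rewrite rmorphM /= rmorph_sign -mulrA; congr (_ * _).
have -> : 'X^(r - #|I|) = \prod_i (if i \in I then 1 else 'X) :> {poly A}.
  rewrite (eq_bigr (fun i => if i \in ~: I then 'X else 1)) => [|i _]; last first.
    by rewrite inE; case: (i \in I).
  by rewrite -big_mkcond prodr_const [#|~: I|]cardsCs setCK card_ord.
rewrite rmorph_prod -big_split /=; apply: eq_bigr => i _; rewrite !mxE.
by case: ifP => _; rewrite ?mulr1 // polyC_natr mulr_natl.
Qed.

Lemma coef_det_char r p (M : 'M[A]_r) : (p <= r)%N ->
  (\det ('X%:M + map_mx polyC M))`_(r - p) *+ p`!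
  = \sum_(a : {ffun 'I_p -> 'I_r}) \det (select a M).
Proof.
move=> pr; rewrite det_char_masks coef_sum sum_det_select; congr (_ *+ _).
rewrite [RHS]big_mkcond; apply: eq_bigr => I _; rewrite coefCM coefXn.
have : (#|I| <= r)%N by rewrite -[r in (_ <= r)%N]card_ord max_card.
have [->|/eqP Ip] := eqVneq #|I| p => Ir; first by rewrite eqxx mulr1.
by case: eqP => E; rewrite ?mulr0 //; case: Ip; move: E Ir pr; lia.
Qed.

End PrincipalMinors.

(** * Even forms and averages over permutations *)

Section EvenForms.
Variables (K : comNzRingType) (N : nat).

Definition even_ext : {pred ext K N} := fun f => has_parity false f.

Lemma even_ext_subring : subring_closed even_ext.
Proof.
split=> [|f g f0 g0|f g f0 g0]; first exact: has_parity1.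
  by apply: has_parityD => //; rewrite -scaleN1r; exact: has_parityZ.
exact: (has_parityM f0 g0).
Qed.

HB.instance Definition _ :=
  GRing.isSubringClosed.Build (ext K N) even_ext even_ext_subring.

(** Determinants over the noncommutative exterior algebra have no good properties;
    even forms make up a commutative subring that contains the curvature. *)
Record even_form := EvenForm { even_val : ext K N; even_valP : even_val \in even_ext }.

HB.instance Definition _ := [isSub for even_val].
HB.instance Definition _ := [Choice of even_form by <:].
HB.instance Definition _ := [SubChoice_isSubNzRing of even_form by <:].

Lemma even_form_mulC : commutative (@GRing.mul even_form).
Proof.
move=> f g; apply: val_inj; rewrite !rmorphM /=.
by rewrite (ext_supercomm (even_valP f) (even_valP g)) mul1r.
Qed.

HB.instance Definition _ := GRing.PzRing_hasCommutativeMul.Build even_form even_form_mulC.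

End EvenForms.

Section BlockPermutations.
Variables (p q : nat).

Definition block_set : {set 'I_(p + q)} := [set j : 'I_(p + q) | (j < p)%N].
Definition block_perms : {group 'S_(p + q)} := ('N(block_set | 'P))%G.

Lemma block_permsP (s : 'S_(p + q)) :
  reflect (forall j, (s j < p)%N = (j < p)%N) (s \in block_perms).
Proof.
apply: (iffP idP) => [/astabsP sN j|sN]; first by have := sN j; rewrite !inE /= apermE.
by apply/astabsP => j; rewrite !inE /= apermE.
Qed.

(** The permutations of one block commute with those of the other and share only the
    identity with them. This makes c_p c_q at least the trace weighted by the average
    over block permutations ([chern_coefM]). *)
Lemma leq_card_block_perms : (p`! * q`! <= #|block_perms|)%N.
Proof.
have cardB : #|block_set| = p.
  transitivity #|lshift q @: 'I_p|; last by rewrite (card_imset _ (@lshift_inj p q)) card_ord.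
  apply: eq_card => j.
  rewrite inE; apply/idP/imsetP => [jp|[k _ ->]]; last exact: ltn_ord k.
  by exists (Ordinal jp) => //; apply: val_inj.
have cardC : #|~: block_set| = q.
  by apply/eqP; rewrite -(eqn_add2l #|block_set|) cardsC cardB card_ord.
have -> : (p`! * q`! = #|(Sym block_set * Sym (~: block_set))%g|)%N.
  rewrite TI_cardMg ?card_Sym ?cardB ?cardC //.
  apply/trivgP/subsetP => s; rewrite !inE => /andP[/subsetP s1 /subsetP s2].
  apply/eqP/permP => j; rewrite perm1; apply/eqP/negPn/negP => sj.
  by have := s1 j sj; have := s2 j sj; rewrite inE => /negP.
rewrite subset_leq_card // mul_subG //; apply/subsetP => s; rewrite inE => sS.
  by apply/block_permsP => j; have := perm_closed j sS; rewrite !inE.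
by apply/block_permsP => j; have := perm_closed j sS; rewrite !inE => /(congr1 negb); rewrite !negbK.
Qed.

End BlockPermutations.

Section MinorProducts.
Variable A : comNzRingType.

Lemma sum_ffun_split (T : finType) p q
    (F : {ffun 'I_p -> T} -> {ffun 'I_q -> T} -> A) :
  \sum_a \sum_b F a b = \sum_(c : {ffun 'I_(p + q) -> T})
    F [ffun i => c (lshift q i)] [ffun j => c (rshift p j)].
Proof.
rewrite pair_big /=.
pose f (c : {ffun 'I_(p + q) -> T}) : {ffun 'I_p -> T} * {ffun 'I_q -> T} :=
  ([ffun i => c (lshift q i)], [ffun j => c (rshift p j)]).
pose g (ab : {ffun 'I_p -> T} * {ffun 'I_q -> T}) : {ffun 'I_(p + q) -> T} :=
  [ffun k => match split k return T with inl i => ab.1 i | inr j => ab.2 j end].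
rewrite (reindex f) //=; exists g => [c _|[a b] _].
  apply/ffunP => k; rewrite ffunE; case: (splitP k) => i ki; rewrite ffunE; congr (c _).
    exact: val_inj.
  exact: val_inj.
rewrite /f; congr (_, _); apply/ffunP => i; rewrite !ffunE.
  by rewrite (unsplitK (inl i)).
by rewrite (unsplitK (inr i)).
Qed.

(** Two minors multiply to the minor of a block diagonal matrix, and only the
    permutations that preserve the blocks contribute to its expansion. *)
Lemma sum_det_selectM r p q (M : 'M[A]_r) :
  (\sum_(a : {ffun 'I_p -> 'I_r}) \det (select a M))
  * (\sum_(b : {ffun 'I_q -> 'I_r}) \det (select b M))
  = \sum_(c : {ffun 'I_(p + q) -> 'I_r}) \sum_(s in block_perms p q)
      (-1) ^+ s * \prod_j M (c j) (c (s j)).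
Proof.
rewrite mulr_suml; under eq_bigr do rewrite mulr_sumr.
rewrite sum_ffun_split; apply: eq_bigr => c _; rewrite -(det_ublock _ 0).
rewrite [RHS]big_mkcond; apply: eq_bigr => s _.
set B := block_mx _ _ _ _.
have BE i j : B i j = if (i < p)%N == (j < p)%N then M (c i) (c j) else 0.
  rewrite /B -[i]splitK -[j]splitK; case: (split i) => i'; case: (split j) => j' /=.
  - by rewrite block_mxEul !mxE !ffunE !ltn_ord.
  - by rewrite block_mxEur mxE ltn_ord ltnNge leq_addr.
  - by rewrite block_mxEdl mxE ltn_ord ltnNge leq_addr.
  - by rewrite block_mxEdr !mxE !ffunE !ltnNge !leq_addr.
under eq_bigr do rewrite BE.
case: block_permsP => sH; first by congr (_ * _); apply: eq_bigr => j _; rewrite sH eqxx.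
have [j sj] : exists j, (s j < p)%N != (j < p)%N.
  apply/existsP; apply: contra_notT sH; rewrite negb_exists => /forallP sH j.
  by have := sH j; rewrite negbK => /eqP.
by rewrite (bigD1 j) //= eq_sym (negPf sj) mul0r mulr0.
Qed.

End MinorProducts.

Section Averages.
Variables (F : numFieldType) (gT : finGroupType).
Implicit Types (G H : {group gT}).

Definition avg (G : {group gT}) (s : gT) : F := (s \in G)%:R / #|G|%:R.

(** As elements of the group algebra, avg H * avg G = avg G for H in G: the
    average over the smaller group fixes the image of the larger one. *)
Lemma avgM G H s : H \subset G -> \sum_t avg H t * avg G (s^-1 * t)%g = avg G s.
Proof.
move=> HG; rewrite (bigID (mem H)) /= [X in _ + X]big1 => [|t /negPf tH]; last first.
  by rewrite /avg tH !mul0r.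
rewrite addr0 (eq_bigr (fun=> avg G s / #|H|%:R)) => [|t tH].
  rewrite sumr_const -(mulr_natr (_ / _)) divfK // pnatr_eq0 -lt0n cardG_gt0 //.
rewrite /avg tH mulrC mul1r; congr (_%:R / _ / _).
by rewrite groupMr ?groupV // (subsetP HG).
Qed.

Lemma avgMr G H s : H \subset G -> \sum_t avg G t * avg H (s^-1 * t)%g = avg G s.
Proof.
move=> HG; rewrite (reindex_inj (mulgI s)) /=; under eq_bigr do rewrite mulKg mulrC.
have sV t : avg G (s * t)%g = avg G (s^-1 ^-1 * t)%g by rewrite invgK.
under eq_bigr do rewrite sV.
by rewrite avgM // /avg groupV.
Qed.

End Averages.

From mathcomp Require Import complex.
From mathcomp Require Import all_classical all_reals all_analysis.
From mathcomp Require Import ring lra.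
Import numFieldNormedType.Exports.
Local Open Scope complex_scope.

(** * Strongly nonnegative forms *)

Section StrongNonnegativity.
Variables (R : realType) (n : nat).
Local Notation C := R[i].
Local Notation form := (ext C (n + n)).
Implicit Types (w f g : form).

Lemma has_parity_gen (K : comNzRingType) N (s : 'I_N) : has_parity true (gen K s).
Proof.
apply/has_parityP => U; rewrite ffunE; have [->|] := eqVneq U [set s]%SET.
  by rewrite cards1.
by rewrite eqxx.
Qed.

Lemma has_parity_prod (K : comNzRingType) N (I : Type) (r : seq I) (P : pred I)
    (F : I -> ext K N) :
  (forall i, P i -> has_parity true (F i)) ->
  has_parity (odd (\sum_(i <- r | P i) 1)) (\prod_(i <- r | P i) F i).
Proof.
move=> FP; elim: r => [|i r IHr]; first by rewrite !big_nil has_parity1.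
rewrite !big_cons; case: ifP => // Pi; rewrite oddD.
by apply: has_parityM => //; apply: FP.
Qed.

Lemma gen_anticomm (K : comNzRingType) N (s t : 'I_N) :
  gen K s * gen K t = - (gen K t * gen K s).
Proof.
by rewrite (ext_supercomm (has_parity_gen _ s) (has_parity_gen _ t)) expr1 mulN1r.
Qed.

Lemma gen_sqr0 (K : comNzRingType) N (s : 'I_N) : gen K s * gen K s = 0.
Proof.
have -> : gen K s = monomial K [set s]%SET by [].
by rewrite monomialM /shuffle_sign disjoints1 inE eqxx scale0r.
Qed.

Definition conj_gen (s : 'I_(n + n)) : form :=
  match fintype.split s with inl a => dzbar R a | inr a => dz R a end.

Lemma conj_genE s : exists t, conj_gen s = gen C t.
Proof. by rewrite /conj_gen; case: fintype.split => a; eexists. Qed.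

(** Conjugation of forms is conjugation of the coefficients followed by the
    substitution that exchanges dz and dzbar. *)
Lemma conj_formM f g : conj_form (f * g) = conj_form f * conj_form g.
Proof.
rewrite /conj_form -/conj_gen -ext_substM; first last.
- by move=> s; have [u ->] := conj_genE s; exact: gen_sqr0.
- by move=> s t; have [u ->] := conj_genE s; have [v ->] := conj_genE t; exact: gen_anticomm.
congr (ext_subst _ _); apply/ffunP => U; rewrite !ffunE rmorph_sum.
apply: eq_bigr => S _; rewrite rmorph_sum; apply: eq_bigr => T _.
rewrite !rmorphM !ffunE; congr (_ * _ * _).
rewrite /shuffle_sign; case: ifP => _; last exact: rmorph0.
by rewrite rmorphXn rmorphN1.
Qed.

Lemma conj_form1 : conj_form (1 : form) = 1.
Proof.
rewrite /conj_form /ext_subst (bigD1 finset.set0) //= [X in _ + X]big1 => [|S /negPf S0].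
  by rewrite addr0 big_set0 !ffunE eqxx rmorph1 scale1r.
by rewrite !ffunE S0 rmorph0 scale0r.
Qed.

Lemma conj_form_prod (I : Type) (r : seq I) (F : I -> form) :
  conj_form (\prod_(i <- r) F i) = \prod_(i <- r) conj_form (F i).
Proof. by apply: (big_morph _ conj_formM conj_form1). Qed.

Lemma has_parity_conj b f : has_parity b f -> has_parity b (conj_form f).
Proof.
move=> /has_parityP fb; rewrite /conj_form -/conj_gen /ext_subst.
apply: (big_ind (fun x => has_parity b x)) => [|x y|S _]; first exact: has_parity0.
  exact: has_parityD.
rewrite ffunE; have [->|/fb <-] := eqVneq (f S) 0.
  by rewrite rmorph0 scale0r has_parity0.
apply: has_parityZ; rewrite -sum1_card; apply: has_parity_prod => s _.
by have [u ->] := conj_genE s; exact: has_parity_gen.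
Qed.

Lemma bidegree_parity p q f : bidegree p q f -> has_parity (odd (p + q)) f.
Proof.
move=> fpq; apply/has_parityP => S /fpq[<- <-]; congr odd.
rewrite -!sum1_card [LHS]big_mkcond big_split_ord /= -!big_mkcond.
by congr (_ + _)%N; apply: eq_bigl => a; rewrite inE.
Qed.

Lemma bidegreeM p q p' q' f g : bidegree p q f -> bidegree p' q' g ->
  bidegree (p + p') (q + q') (f * g).
Proof.
move=> fpq gpq U /extM_support[S [T [/fpq[<- <-] /gpq[<- <-] dST ->]]].
have card_split (h : 'I_n -> 'I_(n + n)) :
    #|[set a | h a \in S :|: T]%SET| = (#|[set a | h a \in S]%SET| + #|[set a | h a \in T]%SET|)%N.
  rewrite -cardsUI.
  have -> : [set a | h a \in S]%SET :&: [set a | h a \in T]%SET = finset.set0.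
    apply/setP => a; rewrite !inE; apply/negP => /andP[aS aT].
    by move/pred0P: dST => /(_ (h a)); rewrite /= aS aT.
  rewrite cards0 addn0.
  by apply: eq_card => a; rewrite !inE.
by rewrite !card_split.
Qed.

Lemma bidegree1 : bidegree 0 0 (1 : form).
Proof.
move=> S; rewrite ffunE; have [->|] := eqVneq S finset.set0; last by rewrite eqxx.
by move=> _; split; apply: eq_card0 => a; rewrite !inE.
Qed.

Lemma bidegree_prod p (F : 'I_p -> form) :
  (forall j, bidegree 1 0 (F j)) -> bidegree p 0 (\prod_j F j).
Proof.
elim: p F => [|p IHp] F F1; first by rewrite big_ord0; exact: bidegree1.
by rewrite big_ord_recl; apply: (bidegreeM (F1 _)); apply: IHp => j.
Qed.

Lemma strongly_nonneg_norm p f : bidegree p 0 f ->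
  strongly_nonneg p ('i%C ^+ (p ^ 2) *: (f * conj_form f)).
Proof. by move=> fp; exists 1%N, (fun=> f); split=> //; rewrite big_ord1. Qed.

Lemma strongly_nonneg0 p : strongly_nonneg p (0 : form).
Proof.
exists 0%N, (fun=> 0); split=> [[]//|].
by rewrite big_ord0 scaler0.
Qed.

Lemma strongly_nonnegD p f g :
  strongly_nonneg p f -> strongly_nonneg p g -> strongly_nonneg p (f + g).
Proof.
move=> [m [u [up ->]]] [k [v [vp ->]]]; exists (m + k)%N.
exists (fun j => match fintype.split j with inl a => u a | inr a => v a end).
split=> [j|]; first by case: fintype.split.
set c := 'i%C ^+ _; rewrite -scalerDr.
congr (_ *: _).
rewrite big_split_ord.
apply: congr2.
apply: eq_bigr => j _; first by rewrite (unsplitK (inl j)).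
by apply: eq_bigr => j _; rewrite (unsplitK (inr j)).
Qed.

Lemma strongly_nonneg_sum p (I : finType) (F : I -> form) :
  (forall i, strongly_nonneg p (F i)) -> strongly_nonneg p (\sum_i F i).
Proof.
by move=> F_ge0; apply: big_ind => // [|x y]; [exact: strongly_nonneg0|exact: strongly_nonnegD].
Qed.

Lemma strongly_nonnegZ p (c : C) f :
  0 <= c -> strongly_nonneg p f -> strongly_nonneg p (c *: f).
Proof.
move=> c0 [m [u [up ->]]]; exists m, (fun j => sqrtC c *: u j); split=> [j|].
  move=> S; rewrite ffunE => cu; apply: (up j); apply: contra_neq cu => ->.
  exact: mulr0.
rewrite scalerA mulrC -scalerA scaler_sumr; congr (_ *: _).
apply: eq_bigr => j _; rewrite conj_formZ -scalerAr -scalerAl scalerA.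
suff -> : (sqrtC c)^*%C * sqrtC c = c by [].
have sqrt_real : sqrtC c \is Num.real by rewrite ger0_real // sqrtC_ge0.
have -> : (sqrtC c)^*%C = sqrtC c by exact: conj_Creal.
by rewrite -expr2 sqrtCK.
Qed.

(** The factor (-1)^'C(p, 2) comes from separating p interleaved (1,0)-forms from
    their p conjugates. *)
Lemma expi_bin2 p : 'i ^+ p * (-1) ^+ 'C(p, 2) = 'i ^+ (p ^ 2) :> C.
Proof.
rewrite -(sqr_i R) -exprM -exprD; congr (_ ^+ _).
rewrite bin2 mul2n; case: p => // p.
by have := odd_double_half (p.+1 * p); rewrite oddM /= andNb; nia.
Qed.

(** The sign absorbed when (p,0)-forms u and (q,0)-forms v are regrouped from
    u conj(u) v conj(v) into u v conj(u v). *)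
Lemma expi_sqrD p q :
  'i ^+ (p ^ 2) * 'i ^+ (q ^ 2) * (-1) ^+ (odd p && odd q) = 'i ^+ ((p + q) ^ 2) :> C.
Proof.
rewrite -oddM signr_odd -(sqr_i R) -exprM -!exprD; congr (_ ^+ _).
by rewrite sqrnD [in RHS](mulnC 2%N) ; lia.
Qed.

Lemma strongly_nonnegM p q f g : strongly_nonneg p f -> strongly_nonneg q g ->
  strongly_nonneg (p + q) (f * g).
Proof.
move=> [m [u [up ->]]] [k [v [vq ->]]].
rewrite -scalerAr -scalerAl mulr_suml !scaler_sumr; apply: strongly_nonneg_sum => a.
rewrite mulr_sumr !scaler_sumr; apply: strongly_nonneg_sum => b.
have /has_parity_conj ua := bidegree_parity (up a).
have vb := bidegree_parity (vq b); rewrite !addn0 in ua vb.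
have -> : u a * conj_form (u a) * (v b * conj_form (v b))
    = (-1) ^+ (odd p && odd q) *: (u a * v b * conj_form (u a * v b)).
  rewrite conj_formM -[LHS]mulrA [conj_form (u a) * _]mulrA (ext_supercomm ua vb).
  case: (_ && _); rewrite ?expr1 ?expr0 ?scale1r ?scaleN1r ?mulN1r ?mul1r.
    by rewrite mulNr mulrN !mulrA.
  by rewrite !mulrA.
rewrite !scalerA [_ ^+ (q ^ 2) * _]mulrC expi_sqrD.
by apply: strongly_nonneg_norm; exact: (bidegreeM (up a) (vq b)).
Qed.

End StrongNonnegativity.

(** * Traces weighted by a function on permutations *)

Section WeightedTraces.
Variables (R : realType) (n r : nat).
Local Notation C := R[i].
Local Notation form := (ext C (n + n)).

(** For u = 1/p! this is the p-th characteristic coefficient of M, and for u the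
    indicator of the block permutations it is proportional to a product of two
    coefficients. *)
Definition weighted_trace p (u : 'S_p -> C) (M : 'M[form]_r) : form :=
  \sum_(a : {ffun 'I_p -> 'I_r}) \sum_s
    u s *: ((-1) ^+ s * \prod_j M (a j) (a (s j))).

Section Gram.
Variables (m : nat) (A : 'M[form]_(r, m)).
Hypothesis A10 : forall i j, bidegree 1 0 (A i j).

Let A_odd i j : has_parity true (A i j).
Proof. exact: (bidegree_parity (@A10 i j)). Qed.

(** The sign of s is compensated by the reordering of the conjugated factors, so
    that s only acts on the column indices k. *)
Lemma gram_prod p (a : {ffun 'I_p -> 'I_r}) (s : 'S_p) :
  (-1) ^+ s * \prod_j (A *m (conj_mx A)^T) (a j) (a (s j))
  = (-1) ^+ 'C(p, 2) * \sum_(k : {ffun 'I_p -> 'I_m})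
      \prod_j A (a j) (k j) * conj_form (\prod_j A (a j) (k ((s^-1)%g j))).
Proof.
under eq_bigr do rewrite mxE.
rewrite bigA_distr_bigA mulr_sumr mulr_sumr; apply: eq_bigr => k _.
under eq_bigr do rewrite !mxE.
rewrite prod_anticomm_pairs => [|i j]; last first.
  by rewrite (ext_supercomm (has_parity_conj (A_odd _ _)) (A_odd _ _)) mulN1r.
rewrite mulr_signCA; congr (_ * _).
have -> : \prod_j conj_form (A (a (s j)) (k j))
    = conj_form (\prod_j A (a (s j)) (k ((s^-1)%g (s j)))).
  by rewrite conj_form_prod; apply: eq_bigr => j _; rewrite permK.
rewrite (@prod_anticomm_perm _ _ (fun j => A (a j) (k ((s^-1)%g j)))) => [|i j _]; last first.
  by rewrite (ext_supercomm (A_odd _ _) (A_odd _ _)) mulN1r.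
rewrite conj_formM.
have -> : conj_form ((-1) ^+ s) = (-1) ^+ s :> form.
  have conjN1 : conj_form (-1) = -1 :> form.
    by rewrite -scaleN1r conj_formZ conj_form1 rmorphN1.
  by case: (odd_perm s); rewrite ?expr1 ?expr0 ?conj_form1.
by rewrite mulr_signCA mulrA -expr2 sqrr_sign mul1r.
Qed.

(** A function u on the symmetric group with u * u = u, in the sense of the second
    hypothesis, acts on functions of k as an orthogonal projection Q, and
    <T, Q T> = <Q T, Q T>. *)
Lemma weighted_trace_gram p (u : 'S_p -> C) :
    (forall s, (u s)^*%R = u s) -> (forall s, \sum_t u t * u (s^-1 * t)%g = u s) ->
  weighted_trace u (A *m (conj_mx A)^T)
  = (-1) ^+ 'C(p, 2) * \sum_(a : {ffun 'I_p -> 'I_r}) \sum_(k : {ffun 'I_p -> 'I_m})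
      (\sum_s u s *: \prod_j A (a j) (k (s j)))
      * conj_form (\sum_s u s *: \prod_j A (a j) (k (s j))).
Proof.
move=> u_real u_idem; rewrite mulr_sumr; apply: eq_bigr => a _.
under eq_bigr do rewrite gram_prod scalerAr.
rewrite -mulr_sumr; congr (_ * _).
pose T (k : {ffun 'I_p -> 'I_m}) (s : 'S_p) : form := \prod_j A (a j) (k (s j)).
pose b s := \sum_k T k 1%g * conj_form (T k (s^-1)%g).
transitivity (\sum_s u s *: b s).
  apply: eq_bigr => s _; congr (_ *: _); apply: eq_bigr => k _; congr (_ * _).
  by apply: eq_bigr => j _; rewrite perm1.
have bE s t : \sum_k T k s * conj_form (T k t) = b (s * t^-1)%g.
  pose h (k : {ffun 'I_p -> 'I_m}) := [ffun j => k (s j)].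
  rewrite /b [RHS](reindex h) /=; last first.
    exists (fun k => [ffun j => k ((s^-1)%g j)]) => k _; apply/ffunP => j.
      by rewrite !ffunE permKV.
    by rewrite !ffunE permK.
  apply: eq_bigr => k _; congr (_ * conj_form _); apply: eq_bigr => j _.
    by rewrite ffunE perm1.
  by rewrite ffunE invMg invgK permM permKV.
(* b is the matrix coefficient of the action of permutations on T; collecting the
   terms with s t^-1 fixed brings in the convolution of u with itself. *)
transitivity (\sum_s \sum_t (u s * u t) *: b (s * t^-1)%g).
  rewrite exchange_big /=; under [RHS]eq_bigr => t _.
    rewrite (reindex_inj (mulIg t)) /=.
    under eq_bigr do rewrite mulgK.
    over.
  rewrite /= exchange_big /=; apply: eq_bigr => s _; rewrite -scaler_suml; congr (_ *: _).
  rewrite -{1}u_idem (reindex_inj (mulgI s)) /=; apply: eq_bigr => t _.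
  by rewrite mulKg.
under eq_bigr => s _ do under eq_bigr => t _ do rewrite -bE scaler_sumr.
under eq_bigr => s _ do rewrite exchange_big /=.
rewrite exchange_big /=; apply: eq_bigr => k _.
rewrite conj_form_sum mulr_suml; apply: eq_bigr => s _; rewrite mulr_sumr.
by apply: eq_bigr => t _; rewrite conj_formZ u_real -scalerAr -scalerAl scalerA [u t * _]mulrC.
Qed.

Lemma curvature_weight p : ('i / (2%:R * pi%:C)) ^+ p * (-1) ^+ 'C(p, 2)
  = (2%:R * pi%:C) ^- p * 'i ^+ (p ^ 2) :> C.
Proof.
rewrite exprMn exprVn mulrAC [RHS]mulrC; congr (_ / _).
exact: expi_bin2.
Qed.

Lemma weighted_traceZ p (u : 'S_p -> C) (c : C) (M : 'M[form]_r) :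
  weighted_trace u (map_mx (fun w => c *: w) M) = c ^+ p *: weighted_trace u M.
Proof.
rewrite /weighted_trace scaler_sumr; apply: eq_bigr => a _.
rewrite scaler_sumr; apply: eq_bigr => s _; rewrite scalerA mulrC -scalerA.
congr (_ *: _); rewrite scalerAr; congr (_ * _).
under eq_bigr do rewrite mxE.
by rewrite scaler_prod prodr_const card_ord.
Qed.

Lemma strongly_nonneg_trace p (u : 'S_p -> C) :
    (forall s, (u s)^*%R = u s) -> (forall s, \sum_t u t * u (s^-1 * t)%g = u s) ->
  strongly_nonneg p (weighted_trace u
    (map_mx (fun w => ('i / (2%:R * pi%:C)) *: w) (A *m (conj_mx A)^T))).
Proof.
move=> u_real u_idem; rewrite weighted_traceZ weighted_trace_gram //.
rewrite ext_signr scalerA curvature_weight -scalerA; apply: strongly_nonnegZ.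
  rewrite invr_ge0 exprn_ge0 // mulr_ge0 ?ler0n //.
  by rewrite lecR pi_ge0.
rewrite scaler_sumr; apply: strongly_nonneg_sum => a.
rewrite scaler_sumr; apply: strongly_nonneg_sum => k.
apply: strongly_nonneg_norm; apply: bidegree_sumZ => s.
by apply: bidegree_prod => j.
Qed.

End Gram.
End WeightedTraces.

(** * Inequalities between Chern forms *)

Section ChernInequalities.
Variables (R : realType) (n r : nat).
Local Notation C := R[i].
Local Notation form := (ext C (n + n)).
Local Notation even := (even_form C (n + n)).

(** For M = i / (2 pi) times the curvature, these are the Chern forms. *)
Definition chern_coef (M : 'M[even]_r) p : form :=
  if (p <= r)%N then val ((\det ('X%:M + map_mx polyC M))`_(r - p)) else 0.

Lemma chern_coefE (M : 'M[even]_r) p : chern_coef M p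
  = p`!%:R^-1 *: val (\sum_(a : {ffun 'I_p -> 'I_r}) \det (select a M)).
Proof.
have pf0 : p`!%:R != 0 :> C by rewrite pnatr_eq0 -lt0n fact_gt0.
rewrite /chern_coef; case: (leqP p r) => pr.
  rewrite -coef_det_char // rmorphMn -[X in _ *: X]scaler_nat scalerA mulVf ?scale1r //.
rewrite big1 ?rmorph0 ?scaler0 // => a _; apply: det_select_eq0.
apply/injectiveP => /(@leq_card 'I_p 'I_r); rewrite !card_ord => /(leq_trans pr).
by rewrite ltnn.
Qed.

Lemma chern_coef_trace (M : 'M[even]_r) p :
  chern_coef M p = weighted_trace (avg C [set: 'S_p]%G) (map_mx val M).
Proof.
rewrite chern_coefE rmorph_sum scaler_sumr; apply: eq_bigr => a _.
rewrite rmorph_sum scaler_sumr; apply: eq_bigr => s _.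
rewrite rmorphM rmorph_prod rmorph_sign /avg inE cardsT card_Sn mul1r.
by congr (_ *: (_ * _)); apply: eq_bigr => j _; rewrite !mxE.
Qed.

Lemma chern_coefM (M : 'M[even]_r) p q : chern_coef M p * chern_coef M q
  = (#|block_perms p q|%:R / (p`! * q`!)%:R)
    *: weighted_trace (avg C (block_perms p q)) (map_mx val M).
Proof.
rewrite !chern_coefE -scalerAr -scalerAl scalerA -rmorphM sum_det_selectM.
rewrite /weighted_trace rmorph_sum !scaler_sumr; apply: eq_bigr => c _.
rewrite rmorph_sum !scaler_sumr big_mkcond; apply: eq_bigr => s _.
rewrite scalerA /avg; case: ifP => _; last by rewrite mul0r mulr0 scale0r.
rewrite mul1r mulrAC divff ?mul1r; last by rewrite pnatr_eq0 -lt0n cardG_gt0.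
rewrite rmorphM rmorph_prod rmorph_sign natrM invfM mulrC.
by congr (_ *: (_ * _)); apply: eq_bigr => j _; rewrite !mxE.
Qed.

Section Inequalities.
Variables (m : nat) (A : 'M[form]_(r, m)) (M : 'M[even]_r).
Hypothesis A10 : forall i j, bidegree 1 0 (A i j).
Hypothesis MA : map_mx val M
  = map_mx (fun w => ('i / (2%:R * pi%:C)) *: w) (A *m (conj_mx A)^T).
Local Notation c := (chern_coef M).

Lemma avg_conj (gT : finGroupType) (G : {group gT}) s :
  (avg C G s)^*%R = avg C G s.
Proof. by rewrite /avg rmorphM fmorphV !rmorph_nat. Qed.

Lemma strongly_nonneg_chern_coef p : strongly_nonneg p (c p).
Proof.
rewrite chern_coef_trace MA; apply: (strongly_nonneg_trace A10) => s.
  exact: avg_conj.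
exact: avgM.
Qed.

(** c_p c_q is t times the trace weighted by the average over block permutations,
    with t >= 1, and the difference of the averages over block permutations and
    over all permutations is again idempotent. *)
Lemma strongly_nonneg_chern_coefM p q : strongly_nonneg (p + q) (c p * c q - c (p + q)).
Proof.
rewrite chern_coefM chern_coef_trace MA.
set H := block_perms p q; set G := [set: _]%G; set K := map_mx _ _; set t := _ / _.
have HG : H \subset G by rewrite finset.subsetT.
have -> : t *: weighted_trace (avg C H) K - weighted_trace (avg C G) K
    = (t - 1) *: weighted_trace (avg C H) K
      + weighted_trace (fun s => avg C H s - avg C G s) K.
  rewrite scalerBl scale1r -addrA; congr (_ + _).
  rewrite [X in _ = - X + _]/weighted_trace addrC -sumrB -sumrN; apply: eq_bigr => a _.
  rewrite -sumrB -sumrN; apply: eq_bigr => s _.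
  by rewrite scalerBl addrAC subrr sub0r.
apply: strongly_nonnegD.
  apply: strongly_nonnegZ.
    rewrite subr_ge0 ler_pdivlMr ?ltr0n ?muln_gt0 ?fact_gt0 //.
    by rewrite mul1r ler_nat leq_card_block_perms.
  by apply: (strongly_nonneg_trace A10) => s; [exact: avg_conj|exact: avgM].
apply: (strongly_nonneg_trace A10) => s.
  by rewrite rmorphB; congr (_ - _); exact: avg_conj.
under eq_bigr do rewrite mulrBl !mulrBr.
rewrite !sumrB (avgM C s HG) (avgMr C s HG) (avgM C s (fintype.subxx G)).
by rewrite (avgM C s (fintype.subxx H)) subrr subr0.
Qed.

Lemma chern_coef0 : c 0 = 1.
Proof.
rewrite chern_coefE fact0 invr1 scale1r (eq_bigr (fun=> 1)) => [|a _]; last first.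
  by rewrite det_mx00.
by rewrite sumr_const card_ffun !card_ord expn0 mulr1n rmorph1.
Qed.

Lemma strongly_nonneg_chern_monomial (l : seq nat) :
  strongly_nonneg (sumn l) (\prod_(p <- l) c p).
Proof.
elim: l => [|p l IHl] /=; first by rewrite big_nil -chern_coef0; exact: strongly_nonneg_chern_coef.
by rewrite big_cons; apply: strongly_nonnegM => //; exact: strongly_nonneg_chern_coef.
Qed.

(** c_(p + s) <= c_p c_s <= c_p c_lambda, where s is the sum of the other parts. *)
Lemma chern_coef_le_monomial (l : seq nat) :
  strongly_nonneg (sumn l) (\prod_(p <- l) c p - c (sumn l)).
Proof.
elim: l => [|p l IHl] /=; first by rewrite big_nil chern_coef0 subrr; exact: strongly_nonneg0.
rewrite big_cons -(subrK (c p * c (sumn l)) (c p * _)) -addrA -mulrBr.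
apply: strongly_nonnegD; last exact: strongly_nonneg_chern_coefM.
by apply: strongly_nonnegM => //; exact: strongly_nonneg_chern_coef.
Qed.

Lemma strongly_nonneg_chern1X p : strongly_nonneg p (c 1 ^+ p).
Proof.
have := strongly_nonneg_chern_monomial (nseq p 1%N).
by rewrite sumn_nseq mul1n big_nseq iter_mulr_1.
Qed.

Lemma chern_coef_le_chern1X p : strongly_nonneg p (c 1 ^+ p - c p).
Proof.
have := chern_coef_le_monomial (nseq p 1%N).
by rewrite sumn_nseq mul1n big_nseq iter_mulr_1.
Qed.

Lemma chern_monomial_le_chern1X (l : seq nat) :
  strongly_nonneg (sumn l) (c 1 ^+ sumn l - \prod_(p <- l) c p).
Proof.
elim: l => [|p l IHl] /=; first by rewrite big_nil subrr; exact: strongly_nonneg0.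
rewrite big_cons exprD -(subrK (c 1 ^+ p * \prod_(q <- l) c q) (c 1 ^+ p * _)).
rewrite -addrA -mulrBr -mulrBl; apply: strongly_nonnegD.
  by apply: strongly_nonnegM => //; exact: strongly_nonneg_chern1X.
apply: strongly_nonnegM; first exact: chern_coef_le_chern1X.
exact: strongly_nonneg_chern_monomial.
Qed.

End Inequalities.
End ChernInequalities.

(** * Densities of top-degree forms *)

Section Density.
Variables (R : realType) (n : nat).
Local Notation C := R[i].
Local Notation form := (ext C (n + n)).

(** The form dz_1 ... dz_n: every (n,0)-form is a multiple of it. *)
Definition holo_mono : form := monomial C [set lshift n a | a : 'I_n]%SET.

Lemma top_holo_form (f : form) : bidegree n 0 f ->
  f = f [set lshift n a | a : 'I_n]%SET *: holo_mono.
Proof.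
move=> fn; rewrite {1}(ext_monomialE f) (bigD1 [set lshift n a | a : 'I_n]%SET) //=.
rewrite big1 ?addr0 // => S SL; have [->|/fn[Sn S0]] := eqVneq (f S) 0.
  by rewrite scale0r.
case/eqP: SL; apply/setP => s; case: (splitP s) => a sa.
  have -> : s = lshift n a by apply: val_inj.
  rewrite imset_f ?inE //; have : a \in [set a | lshift n a \in S]%SET.
    by rewrite (_ : [set a | lshift n a \in S]%SET = finset.setT) ?inE //; apply/eqP;
      rewrite eqEcard finset.subsetT cardsT card_ord Sn leqnn.
  by rewrite inE.
have -> : s = rshift n a by apply: val_inj.
rewrite [RHS](_ : _ = false); last first.
  by apply/negP => /imsetP[b _ /(congr1 (@fintype.split n n))]; rewrite (unsplitK (inl b)) (unsplitK (inr a)).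
apply/negP => aS; have : a \in [set a | rshift n a \in S]%SET by rewrite inE.
by rewrite (finset.cards0_eq S0) inE.
Qed.

(** For y = 0 the quotient is 0. This spares the computation of y below, the
    coefficient of the volume form on the full set of generators. *)
Lemma divr_common_ge0 (z w : C) :
  0 <= z -> 0 <= w -> forall y : C, 0 <= (z * y) / (w * y).
Proof.
move=> z0 w0 y; have [->|y0] := eqVneq y 0; first by rewrite mulr0 mul0r.
by rewrite invfM mulrA mulrAC mulfK ?divr_ge0.
Qed.

(** The volume form is a nonnegative multiple of i^(n^2) psi conj(psi) with psi of
    type (n,0), like the terms of a strongly nonnegative form. *)
Lemma volume_formE : exists2 c : C, 0 <= c & volume_form R n
  = (c * 'i ^+ (n ^ 2)) *: (holo_mono * conj_form holo_mono).
Proof.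
have dz10 : bidegree n 0 (\prod_(a < n) dz R a) by apply: bidegree_prod => a; exact: dz_bidegree.
have -> : volume_form R n = ('i / 2%:R) ^+ n *: \prod_(a < n) (dz R a * dzbar R a).
  by rewrite /volume_form scaler_prod prodr_const card_ord.
rewrite prod_anticomm_pairs => [|a b]; last exact: gen_anticomm.
have -> : \prod_(a < n) dzbar R a = conj_form (\prod_(a < n) dz R a).
  by rewrite conj_form_prod; apply: eq_bigr => a _; rewrite conj_form_dz.
rewrite (top_holo_form dz10); set d := (\prod_(a < n) dz R a) _.
exists (d * d^*%R / 2%:R ^+ n); first by rewrite divr_ge0 ?mul_conjC_ge0 ?exprn_ge0.
rewrite ext_signr conj_formZ -scalerAr -scalerAl !scalerA; congr (_ *: _).
rewrite -expi_bin2.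
rewrite exprMn exprVn; set s := (-1) ^+ _; set t := 'i ^+ n; set q := (2%:R ^+ n)^-1.
by rewrite mulrACA mulrC -!mulrA; congr (_ * _); rewrite [RHS]mulrCA; congr (_ * _); rewrite mulrA mulrC.
Qed.

Lemma density_ge0 (w : form) : strongly_nonneg n w -> 0 <= density w.
Proof.
move=> [m [u [un ->]]]; have [c c0 volE] := volume_formE.
have -> : \sum_j u j * conj_form (u j)
    = (\sum_j u j [set lshift n a | a : 'I_n]%SET * (u j [set lshift n a | a : 'I_n]%SET)^*%R)
      *: (holo_mono * conj_form holo_mono).
  rewrite scaler_suml; apply: eq_bigr => j _; rewrite {1 2}(top_holo_form (un j)).
  by rewrite conj_formZ -scalerAr -scalerAl scalerA mulrC.
rewrite /density volE; set y := holo_mono * _; set z := \sum_j _.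
have z0 : 0 <= z by apply: sumr_ge0 => j _; exact: mul_conjC_ge0.
have zE (a : C) : (a *: y) finset.setT = a * y finset.setT by rewrite ffunE.
rewrite scalerA !zE [_ * z]mulrC -(mulrA z) -(mulrA c).
exact: divr_common_ge0.
Qed.

End Density.

Local Open Scope classical_set_scope.
Local Open Scope ring_scope.
Local Open Scope complex_scope.

(** * Symmetry of second derivatives *)

Section Schwarz.
Variables (R : realType) (V : normedModType R).
Implicit Types (f : V -> R^o) (x a u w : V).

Lemma is_derive_line f x u (s : R) : derivable f (s *: u + x) u ->
  is_derive s 1 (fun t : R => f (t *: u + x) : R^o) ('D_u f (s *: u + x)).
Proof.
have E : (fun h : R => h^-1 *: (((fun t : R => f (t *: u + x) : R^o) \o shift s) (h *: 1)
     - f (s *: u + x)))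
  = (fun h : R => h^-1 *: ((f \o shift (s *: u + x)) (h *: u) - f (s *: u + x))).
  apply/funext => h /=; congr (_ *: (f _ - _)).
  by rewrite scalerDl addrA [h *: 1]mulr1.
by move=> fd; split; [rewrite /derivable E|rewrite /derive E].
Qed.

Lemma line_MVT f x u (t : R) : 0 < t ->
    (forall s, 0 <= s <= t -> derivable f (s *: u + x) u) ->
  exists2 s, 0 <= s <= t & f (t *: u + x) - f x = t * 'D_u f (s *: u + x).
Proof.
move=> t0 fd; pose g (s : R) : R^o := f (s *: u + x).
have gd s : 0 <= s <= t -> is_derive s 1 g ('D_u f (s *: u + x)).
  by move=> st; apply: is_derive_line; apply: fd.
have [s||s st] := @MVT_segment R g (fun s => 'D_u f (s *: u + x)) 0 t (ltW t0).
- by rewrite in_itv /= => /andP[s0 st]; apply: gd; rewrite !ltW.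
- apply: derivable_within_continuous => s; rewrite in_itv /= => st.
  by have [] := gd s st.
by rewrite in_itv /= in st; rewrite /g subr0 scale0r add0r => ->; exists s => //; rewrite mulrC.
Qed.

(** The mean value theorem, applied along u and then along w, turns the second
    difference of f over the parallelogram with sides t u and t w into t^2 times
    a value of the mixed derivative. *)
Lemma second_difference f a u w (t : R) : 0 < t ->
    (forall s s', 0 <= s <= t -> 0 <= s' <= t -> derivable f (s *: u + s' *: w + a) u) ->
    (forall s s', 0 <= s <= t -> 0 <= s' <= t ->
      derivable ('D_u f : V -> R^o) (s *: u + s' *: w + a) w) ->
  exists s s', [/\ 0 <= s <= t, 0 <= s' <= t &
    f (t *: u + t *: w + a) - f (t *: u + a) - f (t *: w + a) + f a
    = t ^+ 2 * 'D_w ('D_u f : V -> R^o) (s *: u + s' *: w + a)].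
Proof.
move=> t0 fu fuw.
have tt : 0 <= t <= t by rewrite ltW // lexx.
have oot : 0 <= (0 : R) <= t by rewrite lexx ltW.
pose g : V -> R^o := fun x => f (x + t *: w) - f x.
have shiftE s s' : s *: u + (s' *: w + a) = s *: u + s' *: w + a by rewrite addrA.
have fd' s : 0 <= s <= t -> derivable (fun x => f (x + t *: w)) (s *: u + a) u /\
    'D_u (fun x => f (x + t *: w)) (s *: u + a) = 'D_u f (s *: u + t *: w + a).
  move=> st.
  have E : (fun h : R => h^-1 *: (((fun x => f (x + t *: w)) \o shift (s *: u + a)) (h *: u)
         - f (s *: u + a + t *: w)))
      = (fun h : R => h^-1 *: ((f \o shift (s *: u + t *: w + a)) (h *: u) - f (s *: u + t *: w + a))).
    apply/funext => h /=.
    have -> : s *: u + a + t *: w = s *: u + t *: w + a by rewrite addrAC.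
    by congr (_ *: (f _ - _)); rewrite -[LHS]addrA [s *: u + a + _]addrAC.
  by split; [rewrite /derivable E; exact: fu|rewrite /derive E].
have fd0 s : 0 <= s <= t -> derivable f (s *: u + a) u.
  by move=> st; have := fu s 0 st oot; rewrite scale0r addr0.
have [|s st gE] := @line_MVT g a u t t0.
  by move=> s st; apply: derivableB; [have [] := fd' s st|exact: fd0].
have [|s' st' gE'] := @line_MVT ('D_u f) (s *: u + a) w t t0.
  by move=> s' st'; rewrite addrA [_ + s *: u]addrC; exact: fuw.
exists s, s'; split; [exact: st|exact: st'|].
have -> : s *: u + s' *: w + a = s' *: w + (s *: u + a) by rewrite addrA [_ + s *: u]addrC.
rewrite expr2 -mulrA -gE'.
have <- : 'D_u g (s *: u + a) = 'D_u f (t *: w + (s *: u + a)) - 'D_u f (s *: u + a).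
  rewrite deriveB; [|by have [] := fd' s st|exact: fd0].
  by have [_ ->] := fd' s st; rewrite addrA [t *: w + _]addrC.
by rewrite -gE /g [t *: u + a + _]addrAC [a + _]addrC opprB addrCA [RHS]addrC.
Qed.

Lemma dist_half_absurd (x1 x2 y : R) :
  `|x1 - y| < `|x1 - x2| / 2 -> `|x2 - y| < `|x1 - x2| / 2 -> False.
Proof.
move=> b1 b2; have := le_lt_trans (ler_distD y x1 x2) (ltrD b1 _).
by rewrite [`|y - x2|]distrC => /(_ _ b2); rewrite -splitr ltxx.
Qed.

(** Both orders of differentiation compute the same second differences of f over
    small parallelograms, and the mixed derivatives are continuous. *)
Lemma deriveC f (O : set V) a u w : open O -> O a ->
    (forall x, O x -> derivable f x u) -> (forall x, O x -> derivable f x w) ->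
    (forall x, O x -> derivable ('D_u f : V -> R^o) x w) ->
    (forall x, O x -> derivable ('D_w f : V -> R^o) x u) ->
    {for a, continuous ('D_w ('D_u f : V -> R^o) : V -> R^o)} ->
    {for a, continuous ('D_u ('D_w f : V -> R^o) : V -> R^o)} ->
  'D_w ('D_u f : V -> R^o) a = 'D_u ('D_w f : V -> R^o) a.
Proof.
move=> openO Oa fu fw fuw fwu cuw cwu.
pose x1 : R := 'D_w ('D_u f : V -> R^o) a; pose x2 : R := 'D_u ('D_w f : V -> R^o) a.
rewrite -/x1 -/x2; apply/eqP; apply: contraT => neq.
have e0 : 0 < `|x1 - x2| / 2 by rewrite divr_gt0 // normr_gt0 subr_eq0.
have near_box (P : set V) : nbhs a P -> exists2 t : R, 0 < t &
    forall s s', 0 <= s <= t -> 0 <= s' <= t -> P (s *: u + s' *: w + a).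
  move=> /nbhs_ballP[d /= d0 dP].
  pose N := `|u| + `|w| + 1.
  have N0 : 0 < N by rewrite ltr_wpDl // addr_ge0.
  (* Dividing by N, which exceeds the sum of the norms, keeps the box in the ball. *)
  exists (d / 2 / N) => [|s s' /andP[s0 st] /andP[s'0 st']]; first by rewrite !divr_gt0.
  apply: dP; rewrite -ball_normE /= opprD addrCA subrr addr0 normrN.
  apply: (le_lt_trans (ler_normD _ _)); rewrite !normrZ !ger0_norm //.
  apply: (@le_lt_trans _ _ (d / 2 / N * (`|u| + `|w|))).
    by rewrite mulrDr lerD // ler_wpM2r.
  apply: (@le_lt_trans _ _ (d / 2 / N * N)).
    by rewrite ler_wpM2l ?divr_ge0 ?ltW // /N; lra.
  by rewrite divfK ?gt_eqF //; lra.
have nO : nbhs a O by exact: open_nbhs_nbhs.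
pose e := `|x1 - x2| / 2; rewrite -/e in e0.
pose B1 : set V := fun y => `|x1 - 'D_w ('D_u f : V -> R^o) y| < e.
pose B2 : set V := fun y => `|x2 - 'D_u ('D_w f : V -> R^o) y| < e.
have n1 : nbhs a B1.
  have /cvgrPdist_lt/(_ _ e0) := cuw; exact.
have n2 : nbhs a B2.
  have /cvgrPdist_lt/(_ _ e0) := cwu; exact.
have [t t0 tP] := near_box (O `&` (B1 `&` B2)) (filterI nO (filterI n1 n2)).
have tO s s' st st' := (tP s s' st st').1.
have [||s1 [s1' [? ? E1]]] := @second_difference f a u w t t0.
- by move=> s s' st st'; apply: fu; exact: tO.
- by move=> s s' st st'; apply: fuw; exact: tO.
have [||s2 [s2' [? ? E2]]] := @second_difference f a w u t t0.
- by move=> s s' st st'; apply: fw; rewrite [_ + s' *: u]addrC; exact: tO.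
- by move=> s s' st st'; apply: fwu; rewrite [_ + s' *: u]addrC; exact: tO.
have b1 := (tP s1 s1' _ _).2.1; have b2 := (tP s2' s2 _ _).2.2.
have {}b1 := b1 ltac:(assumption) ltac:(assumption).
have {}b2 := b2 ltac:(assumption) ltac:(assumption).
rewrite [s2' *: u + _]addrC in b2.
have E12 : 'D_w ('D_u f : V -> R^o) (s1 *: u + s1' *: w + a)
    = 'D_u ('D_w f : V -> R^o) (s2 *: w + s2' *: u + a).
  have t20 : t ^+ 2 != 0 by rewrite expf_neq0 ?gt_eqF.
  have swap : f (t *: u + t *: w + a) - f (t *: u + a) - f (t *: w + a) + f a
      = f (t *: w + t *: u + a) - f (t *: w + a) - f (t *: u + a) + f a.
    by rewrite [t *: w + t *: u]addrC; congr (_ + _); exact: addrAC.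
  exact: (mulfI t20 (etrans (esym E1) (etrans swap E2))).
rewrite /B2 -E12 in b2.
by case: (dist_half_absurd b1 b2).
Qed.

End Schwarz.

(** * Differential calculus of form-valued functions *)

Section ComplexCalculus.
Variables (R : realType) (n : nat).
Local Notation C := R[i].
Local Notation V := 'rV[R]_(n + n).
Local Notation form := (ext C (n + n)).
Implicit Types (f g : V -> C) (v : V) (s t : 'I_(n + n)).

(** Derivability along the coordinate directions only: this is what smoothness
    provides and what the formal derivatives of forms use. *)
Definition cderivable f v := forall s,
  derivable (fun u => complex.Re (f u) : R^o) v (delta_mx ord0 s) /\
  derivable (fun u => complex.Im (f u) : R^o) v (delta_mx ord0 s).

Lemma cderivable_cst (c : C) v : cderivable (fun=> c) v.
Proof. by move=> s; split; exact: derivable_cst. Qed.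

Lemma cderivableD f g v : cderivable f v -> cderivable g v ->
  cderivable (fun u => f u + g u) v.
Proof.
move=> fd gd s; have [f1 f2] := fd s; have [g1 g2] := gd s.
have -> : (fun u => complex.Re (f u + g u) : R^o)
    = (fun u => complex.Re (f u) : R^o) + (fun u => complex.Re (g u) : R^o).
  by apply/funext => u; rewrite fctE raddfD.
have -> : (fun u => complex.Im (f u + g u) : R^o)
    = (fun u => complex.Im (f u) : R^o) + (fun u => complex.Im (g u) : R^o).
  by apply/funext => u; rewrite fctE raddfD.
by split; [exact: (derivableD f1 g1)|exact: (derivableD f2 g2)].
Qed.

Lemma partialCD s f g v : cderivable f v -> cderivable g v ->
  partialC s (fun u => f u + g u) v = partialC s f v + partialC s g v.
Proof.
move=> fd gd; have [f1 f2] := fd s; have [g1 g2] := gd s.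
rewrite /partialC /partial.
have -> : (fun u => complex.Re (f u + g u) : R^o)
    = (fun u => complex.Re (f u) : R^o) + (fun u => complex.Re (g u) : R^o).
  by apply/funext => u; rewrite fctE raddfD.
have -> : (fun u => complex.Im (f u + g u) : R^o)
    = (fun u => complex.Im (f u) : R^o) + (fun u => complex.Im (g u) : R^o).
  by apply/funext => u; rewrite fctE raddfD.
by rewrite (deriveD f1 g1) (deriveD f2 g2); simpc.
Qed.

Lemma complex_ReM (x y : C) : complex.Re (x * y)
  = complex.Re x * complex.Re y - complex.Im x * complex.Im y.
Proof. by case: x => a b; case: y => c d. Qed.

Lemma complex_ImM (x y : C) : complex.Im (x * y)
  = complex.Re x * complex.Im y + complex.Im x * complex.Re y.
Proof. by case: x => a b; case: y => c d. Qed.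

Let reM f g : (fun u => complex.Re (f u * g u) : R^o)
  = (fun u => complex.Re (f u)) * (fun u => complex.Re (g u))
    - (fun u => complex.Im (f u)) * (fun u => complex.Im (g u)) :> (V -> R^o).
Proof. by apply/funext => u; rewrite !fctE complex_ReM. Qed.

Let imM f g : (fun u => complex.Im (f u * g u) : R^o)
  = (fun u => complex.Re (f u)) * (fun u => complex.Im (g u))
    + (fun u => complex.Im (f u)) * (fun u => complex.Re (g u)) :> (V -> R^o).
Proof. by apply/funext => u; rewrite !fctE complex_ImM. Qed.

Lemma cderivableM f g v : cderivable f v -> cderivable g v ->
  cderivable (fun u => f u * g u) v.
Proof.
move=> fd gd s; have [f1 f2] := fd s; have [g1 g2] := gd s.
rewrite reM imM; split.
  exact: (derivableB (derivableM f1 g1) (derivableM f2 g2)).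
exact: (derivableD (derivableM f1 g2) (derivableM f2 g1)).
Qed.

Lemma partialCM s f g v : cderivable f v -> cderivable g v ->
  partialC s (fun u => f u * g u) v = partialC s f v * g v + f v * partialC s g v.
Proof.
move=> fd gd; have [f1 f2] := fd s; have [g1 g2] := gd s.
rewrite /partialC /partial reM imM.
rewrite (deriveB (derivableM f1 g1) (derivableM f2 g2)).
rewrite (deriveD (derivableM f1 g2) (derivableM f2 g1)).
rewrite (deriveM f1 g1) (deriveM f2 g2) (deriveM f1 g2) (deriveM f2 g1).
have leibniz (x y : C) (x1 x2 y1 y2 : R) :
    ((complex.Re x * y1 + complex.Re y * x1) - (complex.Im x * y2 + complex.Im y * x2))
    +i* ((complex.Re x * y2 + complex.Im y * x1) + (complex.Im x * y1 + complex.Re y * x2))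
    = (x1 +i* x2) * y + x * (y1 +i* y2).
  case: x y => [a b] [c d]; apply/eqP; rewrite eq_complex /=.
  by apply/andP; split; apply/eqP; ring.
exact: leibniz.
Qed.

Lemma cderivable_sum (I : Type) (r : seq I) (P : pred I) (F : I -> V -> C) v :
  (forall i, P i -> cderivable (F i) v) ->
  cderivable (fun u => \sum_(i <- r | P i) F i u) v.
Proof.
move=> Fd; elim: r => [|i r IHr].
  have -> : (fun u => \sum_(i <- [::] | P i) F i u) = (fun=> 0).
    by apply/funext => u; rewrite big_nil.
  exact: cderivable_cst.
have -> : (fun u => \sum_(j <- i :: r | P j) F j u)
    = (fun u => if P i then F i u + \sum_(j <- r | P j) F j u
                else \sum_(j <- r | P j) F j u).
  by apply/funext => u; rewrite big_cons.
case Pi: (P i); last exact: IHr.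
exact: (cderivableD (@Fd i Pi) IHr).
Qed.

Lemma cderivable_prod (I : Type) (r : seq I) (P : pred I) (F : I -> V -> C) v :
  (forall i, P i -> cderivable (F i) v) ->
  cderivable (fun u => \prod_(i <- r | P i) F i u) v.
Proof.
move=> Fd; elim: r => [|i r IHr].
  have -> : (fun u => \prod_(i <- [::] | P i) F i u) = (fun=> 1).
    by apply/funext => u; rewrite big_nil.
  exact: cderivable_cst.
have -> : (fun u => \prod_(j <- i :: r | P j) F j u)
    = (fun u => if P i then F i u * \prod_(j <- r | P j) F j u
                else \prod_(j <- r | P j) F j u).
  by apply/funext => u; rewrite big_cons.
case Pi: (P i); last exact: IHr.
exact: (cderivableM (@Fd i Pi) IHr).
Qed.

Lemma cderivable_near f g v : {near v, f =1 g} -> cderivable f v -> cderivable g v.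
Proof.
move=> fg fd s; have [f1 f2] := fd s; split.
  by apply: near_eq_derivable f1; apply: filterS fg => u ->.
by apply: near_eq_derivable f2; apply: filterS fg => u ->.
Qed.

Lemma cderivableV f v : f v != 0 -> cderivable f v -> cderivable (fun u => (f u)^-1) v.
Proof.
move=> fv fd s; have [f1 f2] := fd s.
pose N u : R := complex.Re (f u) ^+ 2 + complex.Im (f u) ^+ 2.
have Nd : derivable (N : V -> R^o) v (delta_mx ord0 s).
  have -> : (N : V -> R^o) = (fun u => complex.Re (f u) : R^o) * (fun u => complex.Re (f u) : R^o)
     + (fun u => complex.Im (f u) : R^o) * (fun u => complex.Im (f u) : R^o) by [].
  exact: (derivableD (derivableM f1 f1) (derivableM f2 f2)).
have NV : derivable (fun u => (N u)^-1 : R^o) v (delta_mx ord0 s).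
  apply: derivableV Nd; apply: contra fv; rewrite /N paddr_eq0 ?sqr_ge0 //.
  by rewrite !sqrf_eq0 eq_complex.
split.
  have -> : (fun u => complex.Re ((f u)^-1) : R^o)
     = (fun u => complex.Re (f u) : R^o) * (fun u => (N u)^-1 : R^o).
    by apply/funext => u; rewrite fctE /N; case: (f u).
  exact: (derivableM f1 NV).
have -> : (fun u => complex.Im ((f u)^-1) : R^o)
   = - ((fun u => complex.Im (f u) : R^o) * (fun u => (N u)^-1 : R^o)).
  by apply/funext => u; rewrite !fctE /N; case: (f u).
exact: (derivableN (derivableM f2 NV)).
Qed.

Lemma cderivable_det p (B : V -> 'M[C]_p) v :
  (forall a b, cderivable (fun u => B u a b) v) -> cderivable (fun u => \det (B u)) v.
Proof.
move=> Bd; rewrite /determinant; apply: cderivable_sum => s _.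
apply: cderivableM; first exact: cderivable_cst.
by apply: cderivable_prod => a _.
Qed.

(** Cramer's formula, valid near v. *)
Lemma cderivable_invmx p (B : V -> 'M[C]_p) v :
    (\forall u \near v, B u \in unitmx) ->
    (forall a b, cderivable (fun u => B u a b) v) ->
  forall a b, cderivable (fun u => invmx (B u) a b) v.
Proof.
move=> Bu Bd a b.
apply: (@cderivable_near (fun u => (\det (B u))^-1 * ((-1) ^+ (b + a) * \det (row' b (col' a (B u)))))).
  by apply: filterS Bu => u Bu; rewrite /invmx Bu !mxE.
apply: cderivableM.
  apply: cderivableV; last exact: cderivable_det.
  by have := nbhs_singleton Bu; rewrite unitmxE unitfE.
apply: cderivableM; first exact: cderivable_cst.
apply: cderivable_det => c d; rewrite (_ : (fun u => _) = (fun u => B u (lift b c) (lift a d))) //.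
by apply/funext => u; rewrite !mxE.
Qed.

End ComplexCalculus.

Section ExteriorDerivative.
Variables (R : realType) (n : nat).
Local Notation C := R[i].
Local Notation V := 'rV[R]_(n + n).
Local Notation form := (ext C (n + n)).
Implicit Types (f g : V -> C) (v : V) (s t : 'I_(n + n)) (w : V -> form).

(** The derivative dual to the generator of index s, so that d and its two parts
    are treated by one formula ([dext_sum]). *)
Definition wirtinger s f v : C :=
  match fintype.split s with inl a => d_dz a f v | inr a => d_dzbar a f v end.

Definition dform s w v : form := [ffun S => wirtinger s (fun u => w u S) v].

Lemma dext_sum w v : dext w v = \sum_s gen C s * dform s w v.
Proof.
rewrite big_split_ord /dext /del /delbar; congr (_ + _); apply: eq_bigr => a _;
  congr (_ * _); apply/ffunP => S; rewrite !ffunE /wirtinger.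
  by rewrite (unsplitK (inl a)).
by rewrite (unsplitK (inr a)).
Qed.

Lemma wirtingerE s : exists (a b : 'I_(n + n)) (c : C), forall f v,
  wirtinger s f v = 2%:R^-1 * partialC a f v + c * partialC b f v.
Proof.
rewrite /wirtinger; case: fintype.split => a.
  exists (lshift n a), (rshift n a), (- ('i / 2%:R)) => f v.
  by rewrite /d_dz mulrBl mulNr mulrC; congr (_ - _); rewrite mulrAC.
exists (lshift n a), (rshift n a), ('i / 2%:R) => f v.
by rewrite /d_dzbar mulrDl mulrC; congr (_ + _); rewrite mulrAC.
Qed.

Lemma wirtingerD s f g v : cderivable f v -> cderivable g v ->
  wirtinger s (fun u => f u + g u) v = wirtinger s f v + wirtinger s g v.
Proof.
move=> fd gd; have [a [b [c E]]] := wirtingerE s.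
by rewrite !E !partialCD // !mulrDr addrACA.
Qed.

Lemma wirtingerM s f g v : cderivable f v -> cderivable g v ->
  wirtinger s (fun u => f u * g u) v = wirtinger s f v * g v + f v * wirtinger s g v.
Proof.
move=> fd gd; have [a [b [c E]]] := wirtingerE s.
rewrite !E (partialCM _ fd gd) (partialCM _ fd gd).
move: (partialC a f v) (partialC b f v) (partialC a g v) (partialC b g v) (f v) (g v).
by move=> *; ring.
Qed.

Lemma partialC_cst s (c : C) v : partialC s (fun=> c) v = 0.
Proof. by rewrite /partialC /partial !derive_cst. Qed.

Lemma wirtinger_cst s (c : C) v : wirtinger s (fun=> c) v = 0.
Proof. by have [a [b [k E]]] := wirtingerE s; rewrite E !partialC_cst !mulr0 addr0. Qed.

Lemma wirtingerZ s (c : C) f v : cderivable f v ->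
  wirtinger s (fun u => c * f u) v = c * wirtinger s f v.
Proof.
by move=> fd; rewrite (wirtingerM _ (cderivable_cst _ _)) // wirtinger_cst mul0r add0r.
Qed.

Lemma wirtinger_sum s (I : finType) (F : I -> V -> C) v :
  (forall i, cderivable (F i) v) ->
  wirtinger s (fun u => \sum_i F i u) v = \sum_i wirtinger s (F i) v.
Proof.
move=> Fd; suff E r : wirtinger s (fun u => \sum_(i <- r) F i u) v
  = \sum_(i <- r) wirtinger s (F i) v by exact: E.
elim: r => [|i r IHr].
  rewrite big_nil (_ : (fun u => _) = (fun=> 0)) ?wirtinger_cst //.
  by apply/funext => u; rewrite big_nil.
have -> : (fun u => \sum_(j <- i :: r) F j u) = (fun u => F i u + \sum_(j <- r) F j u).
  by apply/funext => u; rewrite big_cons.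
have sd : cderivable (fun u => \sum_(j <- r) F j u) v by apply: cderivable_sum => j _.
by rewrite (wirtingerD _ (Fd i) sd) big_cons IHr.
Qed.

Section Smooth.
Variables (O : set V) (f : V -> C).
Hypotheses (openO : open O) (f_smooth : smoothC O f).

Lemma smooth_cderivable v : O v -> cderivable f v.
Proof.
move=> Ov s; have [/(_ 1%N)[_ fR] /(_ 1%N)[_ fI]] := f_smooth.
by split; [exact: (fR s).1|exact: (fI s).1].
Qed.

Lemma smooth_cderivable_partialC s v : O v -> cderivable (partialC s f) v.
Proof.
move=> Ov t; have [/(_ 2)[_ fR] /(_ 2)[_ fI]] := f_smooth.
by split; [exact: ((fR s).2.2 t).1|exact: ((fI s).2.2 t).1].
Qed.

Lemma smooth_cderivable_wirtinger s v : O v -> cderivable (wirtinger s f) v.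
Proof.
move=> Ov; have [a [b [c E]]] := wirtingerE s; rewrite (funext (E f)).
have cd q (k : C) : cderivable (fun u => k * partialC q f u) v.
  exact: (cderivableM (cderivable_cst k v) (smooth_cderivable_partialC q Ov)).
exact: (cderivableD (cd a _) (cd b _)).
Qed.

Lemma smooth_partialCC s t v : O v ->
  partialC s (partialC t f) v = partialC t (partialC s f) v.
Proof.
move=> Ov; have partial_swap (F : V -> R) : smooth O F ->
    partial s (partial t F) v = partial t (partial s F) v.
  move=> /(_ 2)[_ FO].
  exact: (deriveC openO Ov (FO t).1 (FO s).1 ((FO t).2.2 s).1 ((FO s).2.2 t).1
    (((FO t).2.2 s).2.1 v Ov) (((FO s).2.2 t).2.1 v Ov)).
exact: (f_equal2 (@Complex R) (partial_swap _ f_smooth.1) (partial_swap _ f_smooth.2)).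
Qed.

Lemma smooth_wirtingerC s t v : O v ->
  wirtinger s (wirtinger t f) v = wirtinger t (wirtinger s f) v.
Proof.
move=> Ov.
have [a [b [c Es]]] := wirtingerE s; have [a' [b' [c' Et]]] := wirtingerE t.
have d q : cderivable (partialC q f) v by exact: smooth_cderivable_partialC.
have cd q (k : C) : cderivable (fun u => k * partialC q f u) v.
  exact: (cderivableM (cderivable_cst k v) (d q)).
rewrite (funext (Es f)) (funext (Et f)).
rewrite (wirtingerD _ (cd a' _) (cd b' _)) (wirtingerD _ (cd a _) (cd b _)).
rewrite (wirtingerZ _ _ (d a')) (wirtingerZ _ _ (d b')) (wirtingerZ _ _ (d a)).
rewrite (wirtingerZ _ _ (d b)) !Es !Et.
rewrite (smooth_partialCC a a' Ov) (smooth_partialCC a b' Ov).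
rewrite (smooth_partialCC b a' Ov) (smooth_partialCC b b' Ov).
set p1 := partialC a' (partialC a f) v; set p2 := partialC b' (partialC a f) v.
set p3 := partialC a' (partialC b f) v; set p4 := partialC b' (partialC b f) v.
by move: p1 p2 p3 p4 => p1 p2 p3 p4; ring.
Qed.

End Smooth.

Definition fderivable w v := forall S, cderivable (fun u => w u S) v.

Lemma fderivableZ f w v : cderivable f v -> fderivable w v ->
  fderivable (fun u => f u *: w u) v.
Proof.
move=> fd wd S; rewrite (_ : (fun u => _) = (fun u => f u * w u S)).
  exact: (cderivableM fd (wd S)).
by apply/funext => u; rewrite ffunE.
Qed.

Lemma fderivable_sum (I : finType) (F : I -> V -> form) v :
  (forall i, fderivable (F i) v) -> fderivable (fun u => \sum_i F i u) v.
Proof.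
move=> Fd S; rewrite (_ : (fun u => _) = (fun u => \sum_i F i u S)).
  by apply: cderivable_sum => i _; exact: Fd.
by apply/funext => u; rewrite sum_ffunE.
Qed.

Lemma fderivable_cst (c : form) v : fderivable (fun=> c) v.
Proof. by move=> S; exact: cderivable_cst. Qed.

Lemma dextD w1 w2 v : fderivable w1 v -> fderivable w2 v ->
  dext (fun u => w1 u + w2 u) v = dext w1 v + dext w2 v.
Proof.
move=> d1 d2; rewrite !dext_sum -big_split; apply: eq_bigr => s _ /=.
rewrite -mulrDr; congr (_ * _); apply/ffunP => S.
rewrite !ffunE -(wirtingerD _ (d1 S) (d2 S)).
by apply: (congr1 (fun h => wirtinger s h v)); apply/funext => u; rewrite ffunE.
Qed.

Lemma dext_big (I : finType) (F : I -> V -> form) v :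
  (forall i, fderivable (F i) v) ->
  dext (fun u => \sum_i F i u) v = \sum_i dext (F i) v.
Proof.
move=> Fd; under [RHS]eq_bigr do rewrite dext_sum.
rewrite dext_sum exchange_big; apply: eq_bigr => s _ /=.
rewrite -mulr_sumr; congr (_ * _); apply/ffunP => S; rewrite sum_ffunE !ffunE.
under [RHS]eq_bigr do rewrite ffunE.
rewrite -(wirtinger_sum _ (fun i => Fd i S)).
by apply: (congr1 (fun h => wirtinger s h v)); apply/funext => u; rewrite sum_ffunE.
Qed.

Lemma dext_scalar f v : dext (fun u => (f u)%:A : form) v = \sum_s wirtinger s f v *: gen C s.
Proof.
rewrite /dext del_scalar delbar_scalar big_split_ord; congr (_ + _).
  by apply: eq_bigr => a _; rewrite /wirtinger (unsplitK (inl a)).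
by apply: eq_bigr => a _; rewrite /wirtinger (unsplitK (inr a)).
Qed.

Lemma dextZ f w v : cderivable f v -> fderivable w v ->
  dext (fun u => f u *: w u) v = dext (fun u => (f u)%:A) v * w v + f v *: dext w v.
Proof.
move=> fd wd; rewrite dext_scalar !dext_sum mulr_suml scaler_sumr -big_split.
apply: eq_bigr => s _ /=; rewrite -scalerAl scalerAr [f v *: _]scalerAr -mulrDr.
congr (_ * _); apply/ffunP => S; rewrite !ffunE.
rewrite -(wirtingerM _ fd (wd S)).
apply: (congr1 (fun h => wirtinger s h v)).
by apply/funext => u; rewrite ffunE.
Qed.

Lemma dext_scalar_parity f v : has_parity true (dext (fun u => (f u)%:A : form) v).
Proof.
rewrite dext_scalar; apply: (big_ind (fun x => has_parity true x)) => [|x y|s _].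
- exact: has_parity0.
- exact: has_parityD.
- by apply: has_parityZ; exact: has_parity_gen.
Qed.

Lemma fderivable_dext_scalar O f v : smoothC O f -> O v ->
  fderivable (dext (fun u => (f u)%:A : form)) v.
Proof.
move=> f_smooth Ov.
rewrite (_ : dext _ = (fun u => \sum_s wirtinger s f u *: gen C s)); last first.
  by apply/funext => u; exact: dext_scalar.
apply: fderivable_sum => s; apply: fderivableZ; last exact: fderivable_cst.
exact: smooth_cderivable_wirtinger f_smooth _ _ Ov.
Qed.

(** d d f = 0: second derivatives commute while the generators anticommute. *)
Lemma dext_dext_scalar O f v : open O -> smoothC O f -> O v ->
  dext (dext (fun u => (f u)%:A : form)) v = 0.
Proof.
move=> openO f_smooth Ov.
have fd s : cderivable (wirtinger s f) v.
  exact: smooth_cderivable_wirtinger f_smooth _ _ Ov.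
have -> : dext (fun u => (f u)%:A : form) = (fun u => \sum_s wirtinger s f u *: gen C s).
  by apply/funext => u; exact: dext_scalar.
rewrite dext_big => [|s]; last exact: (fderivableZ (fd s) (fderivable_cst _ _)).
pose X := \sum_t \sum_s wirtinger s (wirtinger t f) v *: (gen C s * gen C t).
transitivity X.
  apply: eq_bigr => t _; rewrite (dextZ (fd t) (fderivable_cst _ _)).
  have -> : dext (fun=> gen C t) v = 0.
    rewrite dext_sum big1 // => s _; rewrite (_ : dform _ _ _ = 0) ?mulr0 //.
    by apply/ffunP => S; rewrite !ffunE wirtinger_cst.
  rewrite scaler0 addr0 dext_scalar mulr_suml.
  by apply: eq_bigr => s _; rewrite scalerAl.
(* Exchanging the two summation indices fixes the second derivatives and
   changes the sign of the product of generators. *)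
have XN : X = - X.
  rewrite {1}/X exchange_big -sumrN; apply: eq_bigr => s _.
  rewrite -sumrN; apply: eq_bigr => t _.
  by rewrite gen_anticomm scalerN (smooth_wirtingerC openO f_smooth t s Ov).
have : 2%:R *: X = 0 :> form by rewrite scaler_nat mulr2n {2}XN subrr.
move=> /(congr1 (fun x => 2%:R^-1 *: x)); rewrite scalerA scaler0 mulVf ?scale1r //.
Qed.

End ExteriorDerivative.

(** * The curvature in a frame *)

Section ChartTopology.
Variables (R : realType) (n : nat) (M : topologicalType) (X : complex_manifold R n M).
Local Notation V := 'rV[R]_(n + n).

Lemma chart_image_open (i : chart X) (U : set M) : open U -> open (phi i @` (U `&` cdom i)).
Proof.
move=> openU; rewrite openE => v [x [Ux ix] <-].
have Ov : (phi i @` cdom i) (phi i x) by exists x.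
have n1 : nbhs (phi i x) (phi i @` cdom i).
  by apply: open_nbhs_nbhs; split=> //; exact: phi_open.
have n2 : nbhs (phi i x) (psi i @^-1` U).
  apply: (psi_continuous Ov); rewrite phiK //; exact: open_nbhs_nbhs.
apply: filterS (filterI n1 n2) => u [[y iy <-]]; rewrite /preimage /= phiK // => Uy.
by exists y.
Qed.

(** Applied to the coordinates of a holomorphic frame in its own trivialization,
    which are constant only on the domain of the trivialization. *)
Lemma Ck_near_cst (k : nat) (O : set V) (f : V -> R) (c : R) :
  open O -> (forall v, O v -> f v = c) -> Ck k O f.
Proof.
move=> openO.
have near_cst_cont (g : V -> R) (d : R) : (forall v, O v -> g v = d) ->
    forall v, O v -> {for v, continuous g}.
  move=> gd v Ov.
  have dg : {near v, cst d =1 g} by apply: filterS (open_nbhs_nbhs (conj openO Ov)) => u /gd.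
  by apply: cvg_trans (near_eq_cvg dg) _; rewrite (gd v Ov); exact: cvg_cst.
elim: k f c => [|k IHk] f c fc.
  by split=> // v Ov; exact: (near_cst_cont f c fc v Ov).
split=> [v Ov|s]; first exact: (near_cst_cont f c fc v Ov).
have cf v : O v -> {near v, cst c =1 f}.
  by move=> Ov; apply: filterS (open_nbhs_nbhs (conj openO Ov)) => u /fc.
split=> [v Ov|].
  apply: (@near_eq_derivable _ _ _ (cst c : V -> R^o) _ _ _ (cf v Ov)).
  exact: derivable_cst.
apply: (IHk _ 0) => v Ov; rewrite /partial.
rewrite -(@near_eq_derive _ _ _ (cst c : V -> R^o) f v _ (cf v Ov)).
exact: derive_cst.
Qed.

End ChartTopology.

Lemma curvature_algebra (A : nzRingType) p q (T dT : 'M[A]_p) (s ds : 'M[A]_(p, q)) :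
  dT *m s - T *m ds + T *m (ds + T *m s) = (dT + T *m T) *m s.
Proof. by rewrite mulmxDl mulmxDr mulmxA addrA subrK. Qed.

(** A connection is a derivation over scalars and d d = 0, so the derivatives of
    g cancel in its square, which is linear over functions. *)
Lemma covariant_square (R : realType) n r m (theta : 'rV[R]_(n + n) -> 'M[ext R[i] (n + n)]_r)
    (W : set 'rV[R]_(n + n)) (g : 'rV[R]_(n + n) -> 'M[R[i]]_(r, m)) v :
    open W -> W v -> (forall a b, smoothC W (fun u => g u a b)) ->
    (forall a b, has_parity true (theta v a b)) ->
    (forall a b, fderivable (fun u => theta u a b) v) ->
  let nab (sigma : 'rV[R]_(n + n) -> 'M[ext R[i] (n + n)]_(r, m)) u :=
    dext_mx sigma u + theta u *m sigma u in
  nab (nab (fun u => scalar_forms n (g u))) v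
  = (dext_mx theta v + theta v *m theta v) *m scalar_forms n (g v).
Proof.
move=> openW Wv g_smooth theta_odd theta_der nab.
pose sg u := scalar_forms n (g u).
suff dN : dext_mx (nab sg) v = dext_mx theta v *m sg v - theta v *m dext_mx sg v.
  exact: (etrans (congr1 (fun D => D + theta v *m nab sg v) dN) (curvature_algebra _ _ _ _)).
have gd p q : cderivable (fun u => g u p q) v by exact: smooth_cderivable (g_smooth p q) _ Wv.
have sE p q u : sg u p q = (g u p q)%:A by rewrite mxE.
have dE p q u : dext_mx sg u p q = dext (fun u => (g u p q)%:A) u.
  rewrite mxE; apply: (congr1 (fun F => dext F u)); apply/funext => u'; exact: sE.
apply/matrixP => a b.
have -> : dext_mx (nab sg) v a b
    = dext (fun u => dext (fun u' => (g u' a b)%:A) u + \sum_c g u c b *: theta u a c) v.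
  rewrite mxE; apply: (congr1 (fun F => dext F v)); apply/funext => u.
  rewrite mxE dE mxE; congr (_ + _).
  by apply: eq_bigr => c _; rewrite sE -scalerAr mulr1.
rewrite (dextD (fderivable_dext_scalar (g_smooth a b) Wv)
  (fderivable_sum (fun c => fderivableZ (gd c b) (theta_der a c)))).
rewrite (dext_dext_scalar openW (g_smooth a b) Wv) add0r.
rewrite (dext_big (fun c => fderivableZ (gd c b) (theta_der a c))).
rewrite [RHS]mxE [X in X + _]mxE [X in _ + X]mxE [X in _ - X]mxE -sumrN -big_split.
apply: eq_bigr => c _ /=.
rewrite (dextZ (gd c b) (theta_der a c)) dE sE mxE.
have swap : dext (fun u => (g u c b)%:A) v * theta v a c
    = - (theta v a c * dext (fun u => (g u c b)%:A) v).
  exact: etrans (ext_supercomm (dext_scalar_parity _ _) (theta_odd a c)) (mulN1r _).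
by rewrite swap addrC -scalerAr mulr1.
Qed.

Section Gauge.
Variables (R : realType) (n : nat) (M : topologicalType).
Variables (X : complex_manifold R n M) (r : nat) (E : holo_bundle X r).
Variable h : hermitian_metric E.
Local Notation C := R[i].
Local Notation V := 'rV[R]_(n + n).
Local Notation form := (ext C (n + n)).

Section LocalFrame.
Variables (i : chart X) (k : tindex E).
Let O := phi i @` (cdom i `&` tdom k).
Let theta := chern_connection h i k.

Lemma chern_domain_open : open O.
Proof. by rewrite /O setIC; apply: chart_image_open; exact: tdom_open. Qed.

Lemma gram_smooth a b : smoothC O (fun v => gram h k (psi i v) a b).
Proof.
rewrite (_ : (fun v => _) = (fun v => hmet h (holo_frame k (psi i v) a) (holo_frame k (psi i v) b))).
  exact: hmet_smooth.
by apply/funext => v; rewrite mxE.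
Qed.

Lemma chern_connectionE v a b : theta v a b = \sum_c \sum_e
    (invmx (gram h k (psi i v))^T a c * wirtinger (lshift n e) (fun u => gram h k (psi i u) b c) v)
    *: dz R e.
Proof.
rewrite mxE; apply: eq_bigr => c _; rewrite !mxE.
rewrite (_ : (fun u => scalar_forms n _ c b) = (fun u => (gram h k (psi i u) b c)%:A)); last first.
  by apply/funext => u; rewrite !mxE.
rewrite del_scalar mulr_sumr; apply: eq_bigr => e _.
by rewrite -scalerAl mul1r scalerA /wirtinger (unsplitK (inl e)).
Qed.

Lemma chern_connection_parity v a b : has_parity true (theta v a b).
Proof.
rewrite chern_connectionE; apply: (big_ind (fun x => has_parity true x)) => [|x y|c _].
- exact: has_parity0.
- exact: has_parityD.
apply: (big_ind (fun x => has_parity true x)) => [|x y|e _].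
- exact: has_parity0.
- exact: has_parityD.
- by apply: has_parityZ; exact: has_parity_gen.
Qed.

Lemma chern_connection_derivable v a b : O v -> fderivable (fun u => theta u a b) v.
Proof.
move=> Ov; rewrite (funext (fun u => chern_connectionE u a b)).
apply: fderivable_sum => c; apply: fderivable_sum => e.
apply: (fderivableZ _ (fderivable_cst _ _)); apply: cderivableM.
  apply: (cderivable_invmx (B := fun u => (gram h k (psi i u))^T)).
    apply: filterS (open_nbhs_nbhs (conj chern_domain_open Ov)) => u [x [ix kx] <-].
    by rewrite unitmx_tr phiK //; exact: gram_unit.
  move=> p q; rewrite (_ : (fun u => _) = (fun u => gram h k (psi i u) q p)).
    exact: (smooth_cderivable (gram_smooth q p) Ov).
  by apply/funext => u; rewrite mxE.
exact: (smooth_cderivable_wirtinger (gram_smooth b c) _ Ov).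
Qed.

Lemma nabla_nabla m (W : set V) (g : V -> 'M[C]_(r, m)) v :
    open W -> W v -> O v -> (forall a b, smoothC W (fun u => g u a b)) ->
  nabla h i k (nabla h i k (fun u => scalar_forms n (g u))) v
  = (dext_mx theta v + theta v *m theta v) *m scalar_forms n (g v).
Proof.
move=> openW Wv Ov g_smooth.
apply: (covariant_square openW Wv g_smooth) => a b.
  exact: chern_connection_parity.
exact: chern_connection_derivable.
Qed.

End LocalFrame.
End Gauge.

Section EvenMatrices.
Variables (R : realType) (n r : nat).
Local Notation C := R[i].
Local Notation form := (ext C (n + n)).
Local Notation even := (even_form C (n + n)).

Definition evenize p q (B : 'M[form]_(p, q)) : 'M[even]_(p, q) :=
  map_mx (insubd (0 : even)) B.

Lemma evenizeK p q (B : 'M[form]_(p, q)) :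
  (forall a b, has_parity false (B a b)) -> map_mx val (evenize B) = B.
Proof. by move=> B_even; apply/matrixP => a b; rewrite !mxE insubdK //; exact: B_even. Qed.

(** Identities between even matrices are checked in the exterior algebra. *)
Lemma map_val_inj p q : injective (map_mx val : 'M[even]_(p, q) -> 'M[form]_(p, q)).
Proof.
by move=> A B AB; apply/matrixP => a b; apply: val_inj; move/matrixP: AB => /(_ a b); rewrite !mxE.
Qed.

Lemma det_map_nz (aR : comNzRingType) (rR : nzRingType) (f : {rmorphism aR -> rR}) p
  (B : 'M[aR]_p) : \det (map_mx f B) = f (\det B).
Proof.
rewrite rmorph_sum; apply: eq_bigr => s _; rewrite rmorphM rmorph_sign rmorph_prod.
by congr (_ * _); apply: eq_bigr => a _; rewrite mxE.
Qed.

Lemma chern_coef_formE (K : 'M[even]_r) (B : 'M[form]_r) (c : C) p :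
    map_mx val K = map_mx (fun w => c *: w) B ->
  chern_coef K p = if (p <= r)%N
    then (\det ('X%:M + map_mx (fun w => (c *: w)%:P) B))`_(r - p) else 0.
Proof.
move=> KB; rewrite /chern_coef; case: ifP => // _.
rewrite -(coef_map val) -(det_map_nz (map_poly val)).
apply: (congr1 (fun q : {poly form} => q`_(r - p))); congr (\det _).
apply/matrixP => a b; rewrite !mxE; apply/polyP => j.
transitivity (val ('X *+ (a == b) + (K a b)%:P)`_j); first exact: coef_map.
rewrite !coefD !coefMn !coefX !coefC rmorphD rmorphMn rmorph_nat.
move/matrixP: KB => /(_ a b); rewrite !mxE => <-.
by case: (j == 0%N); rewrite ?rmorph0.
Qed.

Lemma chern_coef_conj (G G' K : 'M[even]_r) p :
  G *m G' = 1%:M -> chern_coef (G *m K *m G') p = chern_coef K p.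
Proof.
move=> GG'; rewrite /chern_coef; case: (p <= r)%N; last by [].
have detGG' : \det (map_mx polyC G) * \det (map_mx polyC G') = 1.
  by rewrite -det_mulmx -map_mxM GG' map_mx1 det1.
(* X commutes with G, so that conjugation by G passes to X + K. *)
suff -> : 'X%:M + map_mx polyC (G *m K *m G')
    = map_mx polyC G *m ('X%:M + map_mx polyC K) *m map_mx polyC G'.
  by rewrite !det_mulmx mulrAC detGG' mul1r.
rewrite mulmxDr mulmxDl -!map_mxM; congr (_ + _).
by rewrite scalar_mxC -mulmxA -map_mxM GG' map_mx1 mulmx1.
Qed.

End EvenMatrices.

Section ChernForms.
Variables (R : realType) (n : nat) (M : topologicalType).
Variables (X : complex_manifold R n M) (r : nat) (E : holo_bundle X r).
Variable h : hermitian_metric E.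
Local Notation C := R[i].
Local Notation V := 'rV[R]_(n + n).
Local Notation form := (ext C (n + n)).

Lemma chart_point (i : chart X) v : (phi i @` cdom i) v ->
  cdom i (psi i v) /\ phi i (psi i v) = v.
Proof. by move=> [x ix <-]; rewrite phiK. Qed.

Definition holo_curvature (i : chart X) (k : tindex E) (v : V) : 'M[form]_r :=
  dext_mx (chern_connection h i k) v + chern_connection h i k v *m chern_connection h i k v.

Lemma curvature_matrixE (W : set M) (e : frame E) (i : chart X) v :
    open W -> W (psi i v) -> (phi i @` cdom i) v ->
    (forall a b, smoothC (phi i @` (W `&` (cdom i `&` tdom (triv_at E (psi i v)))))
      (fun u => frame_coord (triv_at E (psi i v)) e (psi i u) a b)) ->
  let k := triv_at E (psi i v) in
  curvature_matrix h e i v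
  = scalar_forms n (invmx (frame_coord k e (psi i v)))
    *m (holo_curvature i k v *m scalar_forms n (frame_coord k e (psi i v))).
Proof.
move=> openW Wx iv e_smooth k; have [ix phi_v] := chart_point iv.
have kx : tdom k (psi i v) := triv_atP E (psi i v).
have WE : W `&` (cdom i `&` tdom k) = (W `&` tdom k) `&` cdom i.
  by rewrite setIA setIAC.
have openW' : open (phi i @` (W `&` (cdom i `&` tdom k))).
  by rewrite WE; apply: chart_image_open; apply: openI => //; exact: tdom_open.
have Wv : (phi i @` (W `&` (cdom i `&` tdom k))) v by exists (psi i v).
have Ov : (phi i @` (cdom i `&` tdom k)) v by exists (psi i v).
have := nabla_nabla h openW' Wv Ov e_smooth.
exact: congr1.
Qed.

Lemma frame_coord_holo (k : tindex E) x : tdom k x -> frame_coord k (holo_frame k) x = 1%:M.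
Proof.
move=> kx; apply/matrixP => a b; rewrite !mxE untrivK // !mxE eqxx andbT.
by [].
Qed.

Lemma scalar_forms1 : scalar_forms n (1%:M : 'M[C]_r) = 1%:M.
Proof.
by apply/matrixP => a b; rewrite !mxE; case: eqP => _; rewrite ?scale1r ?scale0r.
Qed.

(** In the frame of the trivialization the coordinates are the identity matrix on a
    neighbourhood of the point. *)
Lemma curvature_matrix_holo (i : chart X) v : (phi i @` cdom i) v ->
  curvature_matrix h (holo_frame (triv_at E (psi i v))) i v
  = holo_curvature i (triv_at E (psi i v)) v.
Proof.
move=> iv; set k := triv_at E (psi i v).
have [ix phi_v] := chart_point iv.
have kx : tdom k (psi i v) := triv_atP E (psi i v).
have := @curvature_matrixE (tdom k) (holo_frame k) i v (tdom_open k) kx iv.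
rewrite /= -/k frame_coord_holo // invmx1 scalar_forms1 mul1mx mulmx1; apply => a b.
have openO : open (phi i @` (tdom k `&` (cdom i `&` tdom k))).
  by rewrite setIA setIAC; apply: chart_image_open; apply: openI; exact: tdom_open.
have gE u : (phi i @` (tdom k `&` (cdom i `&` tdom k))) u ->
    frame_coord k (holo_frame k) (psi i u) a b = (1%:M : 'M[C]_r) a b.
  by move=> [y [_ [iy ky]] <-]; rewrite phiK // frame_coord_holo.
by split=> m; apply: Ck_near_cst openO _ => u /gE ->.
Qed.

(** A linear relation between the coordinates of orthonormal vectors is a linear
    relation between the vectors, and pairing it with each of them kills its
    coefficients. *)
Lemma unitary_frame_unit (W : set M) (e : frame E) (k : tindex E) x :
  unitary_frame h W e -> W x -> tdom k x -> frame_coord k e x \in unitmx.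
Proof.
move=> [_ e_unit] Wx kx; have [//|] := boolP (_ \in unitmx).
rewrite unitmxE unitfE negbK -det_tr => /det0P[c c_neq0 cG].
pose u : fib E x := \sum_a c ord0 a *: e x a.
have hl (w : fib E x) : hmet h u w = \sum_a c ord0 a * hmet h (e x a) w.
  apply: (big_ind2 (fun y z => hmet h y w = z)) => [|y1 z1 y2 z2 <- <-|a _].
  - exact: hmet0.
  - by have := hmet_linear h 1 y1 y2 w; rewrite scale1r mul1r.
  - by have := hmet_linear h (c ord0 a) (e x a) 0 w; rewrite addr0 hmet0 addr0.
have tl := triv_linear kx.
have t0 : triv k (0 : fib E x) = 0.
  by have := tl (-1) 0 0; rewrite scaler0 addr0 scaleN1r addNr.
have tu : triv k u = \sum_a c ord0 a *: triv k (e x a).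
  apply: (big_ind2 (fun y z => triv k y = z)) => [//|y1 z1 y2 z2 <- <-|a _].
  - by have := tl 1 y1 y2; rewrite !scale1r.
  - by have := tl (c ord0 a) (e x a) 0; rewrite addr0 t0 addr0.
have u0 : u = 0.
  rewrite -(trivK kx u) tu -[RHS](trivK kx) t0; congr untriv.
  apply/colP => a; rewrite summxE.
  transitivity ((c *m (frame_coord k e x)^T) ord0 a); last by rewrite cG !mxE.
  by rewrite mxE; apply: eq_bigr => b _; rewrite !mxE.
case/eqP: c_neq0; apply/rowP => a; rewrite mxE.
have := hl (e x a); rewrite u0 hmet0 (bigD1 a) //= e_unit // eqxx mulr1 big1 ?addr0 // => b ba.
by rewrite e_unit // (negPf ba) mulr0.
Qed.

Lemma map_mx_scaler p q s (c : C) (A : 'M[form]_(p, q)) (B : 'M[form]_(q, s)) :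
  A *m map_mx (fun w => c *: w) B = map_mx (fun w => c *: w) (A *m B).
Proof.
apply/matrixP => a b; rewrite !mxE scaler_sumr; apply: eq_bigr => d _.
by rewrite !mxE scalerAr.
Qed.

Lemma map_mx_scalel p q s (c : C) (A : 'M[form]_(p, q)) (B : 'M[form]_(q, s)) :
  map_mx (fun w => c *: w) A *m B = map_mx (fun w => c *: w) (A *m B).
Proof.
apply/matrixP => a b; rewrite !mxE scaler_sumr; apply: eq_bigr => d _.
by rewrite !mxE scalerAl.
Qed.

Lemma conj_map_mx_scale p (c : C) (P P' B : 'M[form]_p) : P *m P' = 1%:M ->
  P *m map_mx (fun w => c *: w) (P' *m (B *m P)) *m P' = map_mx (fun w => c *: w) B.
Proof.
move=> PP'; rewrite map_mx_scaler map_mx_scalel.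
by rewrite (mulmxA P P') PP' mul1mx -mulmxA PP' mulmx1.
Qed.

Lemma scalar_formsM p q s (A : 'M[C]_(p, q)) (B : 'M[C]_(q, s)) :
  scalar_forms n (A *m B) = scalar_forms n A *m scalar_forms n B.
Proof.
apply/matrixP => a b; rewrite !mxE scaler_suml; apply: eq_bigr => c _.
by rewrite !mxE -scalerAl mul1r scalerA.
Qed.

Lemma scalar_forms_even p q (A : 'M[C]_(p, q)) a b : has_parity false (scalar_forms n A a b).
Proof. by rewrite mxE; apply: has_parityZ; exact: has_parity1. Qed.

(** The matrix whose elementary symmetric invariants are the Chern forms when the
    curvature is A times its conjugate transpose. *)
Definition chern_gram m (A : 'M[form]_(r, m)) : 'M[form]_r :=
  map_mx (fun w => ('i / (2%:R * pi%:C)) *: w) (A *m (conj_mx A)^T).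

Lemma chern_gram_even m (A : 'M[form]_(r, m)) : (forall a b, bidegree 1 0 (A a b)) ->
  forall a b, has_parity false (chern_gram A a b).
Proof.
move=> A10 a b; have A_odd c d : has_parity true (A c d).
  exact: (bidegree_parity (@A10 c d)).
rewrite !mxE; apply: has_parityZ.
apply: (big_ind (fun x => has_parity false x)) => [|y z|l _].
- exact: has_parity0.
- exact: has_parityD.
- rewrite !mxE; exact: (has_parityM (A_odd a l) (has_parity_conj (A_odd b l))).
Qed.

(** The curvatures in a unitary frame and in the holomorphic frame are conjugate
    by an invertible matrix of functions, hence have the same Chern forms. *)
Lemma chern_form_unitary (W : set M) (e : frame E) (i : chart X) v m (A : 'M[form]_(r, m)) p :
    open W -> W (psi i v) -> (phi i @` cdom i) v -> unitary_frame h W e ->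
    (forall a b, bidegree 1 0 (A a b)) ->
    curvature_matrix h e i v = A *m (conj_mx A)^T ->
  chern_form h p i v
  = chern_coef (evenize (chern_gram A)) p.
Proof.
move=> openW Wx iv e_unit A10 curvE; pose c : C := 'i / (2%:R * pi%:C).
pose k := triv_at E (psi i v).
have kx : tdom k (psi i v) := triv_atP E (psi i v).
pose g := frame_coord k e (psi i v).
have gU : g \in unitmx := unitary_frame_unit e_unit Wx kx.
have gauge := curvature_matrixE openW Wx iv (e_unit.1 i k); rewrite curvE /= -/k -/g in gauge.
have curv0 := curvature_matrix_holo iv; rewrite -/k in curv0.
transitivity (if (p <= r)%N
    then (\det ('X%:M + map_mx (fun w => (c *: w)%:P) (holo_curvature i k v)))`_(r - p) else 0).
  exact: (congr1 (fun B : 'M[form]_r => if (p <= r)%N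
    then (\det ('X%:M + map_mx (fun w => (c *: w)%:P) B))`_(r - p) else 0) curv0).
move: (holo_curvature i k v) gauge => Theta gauge.
set K := evenize _; have KE : map_mx val K = _ := evenizeK (chern_gram_even A10).
pose G := evenize (scalar_forms n g); pose G' := evenize (scalar_forms n (invmx g)).
have GE : map_mx val G = scalar_forms n g by apply: evenizeK; exact: scalar_forms_even.
have G'E : map_mx val G' = scalar_forms n (invmx g) by apply: evenizeK; exact: scalar_forms_even.
have PP' : scalar_forms n g *m scalar_forms n (invmx g) = 1%:M.
  by rewrite -scalar_formsM (mulmxV gU) scalar_forms1.
have GG' : G *m G' = 1%:M.
  by apply: map_val_inj; rewrite map_mxM GE G'E PP' map_mx1.
rewrite -(chern_coef_conj K p GG'); apply/esym; apply: chern_coef_formE.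
rewrite !map_mxM GE G'E KE /chern_gram gauge.
exact: conj_map_mx_scale.
Qed.

End ChernForms.

(** * Iterated integrals of compactly supported continuous functions *)

Section IteratedIntegral.
Variable R : realType.

(** The support condition is put on each coordinate, so that it passes to the
    slices with the same bound B. *)
Definition cont_box m (B : R) (f : 'rV[R]_m -> R) : Prop :=
  continuous (f : 'rV[R]_m -> R^o) /\
  forall (v : 'rV[R]_m) (j : 'I_m), B < `|v ord0 j| -> f v = 0.

Definition slice m (f : 'rV[R]_m.+1 -> R) (x : R) : 'rV[R]_m -> R :=
  fun v => f (row_mx (const_mx x : 'rV[R]_1) v).

Lemma cons_row_head m x (v : 'rV[R]_m) i (k : 'I_1) :
  (row_mx (const_mx x : 'rV[R]_1) v : 'rV[R]_m.+1) i (lshift m k) = x.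
Proof. by apply: etrans (row_mxEl _ _ _ _) _; rewrite mxE. Qed.

Lemma cons_row_tail m x (v : 'rV[R]_m) i k :
  (row_mx (const_mx x : 'rV[R]_1) v : 'rV[R]_m.+1) i (rshift 1 k) = v i k.
Proof. exact: row_mxEr. Qed.

Lemma slice_continuous2 m (f : 'rV[R]_m.+1 -> R) x0 (v0 : 'rV[R]_m) :
    continuous (f : 'rV[R]_m.+1 -> R^o) -> forall e : R, 0 < e ->
  exists U1 U2, [/\ nbhs x0 U1, nbhs v0 U2 &
    forall x v, U1 x -> U2 v -> `|slice f x0 v0 - slice f x v| < e].
Proof.
move=> cf e e0.
have /cvgrPdist_lt/(_ _ e0) := cf (row_mx (const_mx x0 : 'rV[R]_1) v0).
case/nbhs_ballP => d /= d0 dP.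
exists (ball x0 d), (ball v0 d); split; [exact: nbhsx_ballx|exact: nbhsx_ballx|].
move=> x v /= xd [_ vd]; apply: dP; split=> // i j.
rewrite ord1 -(@splitK 1 m j); case: (@fintype.split 1 m j) => k /=.
  by rewrite !cons_row_head.
by rewrite !cons_row_tail.
Qed.

Lemma slice_cont_box m B (f : 'rV[R]_m.+1 -> R) x :
  cont_box B f -> cont_box B (slice f x).
Proof.
move=> [cf fB]; split=> [v|v j vj].
  apply/(@cvgrPdist_lt _ _ _ (nbhs v) (nbhs_filter v)) => e e0.
  have [U1 [U2 [xU vU UP]]] := slice_continuous2 x v cf e0.
  apply: (@filterS _ (nbhs v) (nbhs_filter v) U2) => // u uU; apply: UP => //.
  exact: nbhs_singleton xU.
by apply: (fB _ (rshift 1 j)); rewrite cons_row_tail.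
Qed.

Lemma slice_out m B (f : 'rV[R]_m.+1 -> R) x :
  cont_box B f -> B < `|x| -> slice f x = fun=> 0.
Proof.
move=> [_ fB] xB; apply/funext => v; apply: (fB (row_mx (const_mx x : 'rV[R]_1) v) (@lshift 1 m ord0)).
by rewrite cons_row_head.
Qed.

Lemma integral_rV0 m : integral_rV (fun _ : 'rV[R]_m => 0) = 0 :> R.
Proof.
elim: m => //= m IHm; under eq_Rintegral do rewrite IHm.
by rewrite Rintegral_cst // mul0r.
Qed.

(** Tube lemma: by compactness of the box the slices depend on x uniformly. *)
Lemma slice_uniform m B (f : 'rV[R]_m.+1 -> R) x0 (e : R) :
    cont_box B f -> 0 < e ->
  \forall x \near x0, forall v, `|slice f x0 v - slice f x v| <= e.
Proof.
move=> [cf fB] e0.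
pose K := [set v : 'rV[R]_m | forall j, (`[- B, B]%classic : set R) (v ord0 j)].
have cK : compact K by apply: (@rV_compact _ _ (fun=> `[- B, B]%classic)) => _; exact: segment_compact.
have e20 : 0 < e / 2 by rewrite divr_gt0.
have KP : \forall x \near x0, K `<=` [set v | `|slice f x0 v - slice f x v| <= e].
  have covK := (compact_near_coveringP K).1 cK.
  apply: (covK R (nbhs x0) (fun x v => `|slice f x0 v - slice f x v| <= e) (nbhs_filter x0)).
  move=> v _; have [U1 [U2 [xU vU UP]]] := slice_continuous2 x0 v cf e20.
  exists (U2, U1) => //= -[u x] [/= uU xU'].
  have h1 := UP x0 u (nbhs_singleton xU) uU; have h2 := UP x u xU' uU.
  apply: (le_trans (ler_distD (slice f x0 v) _ _)).
  by rewrite [X in X + _]distrC [e]splitr; apply: lerD; apply: ltW.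
apply: filterS KP => x KP v; have [vK|/existsNP[j vj]] := pselect (K v); first exact: KP.
have vB : B < `|v ord0 j|.
  by rewrite ltNge; apply/negP => vB; apply: vj; rewrite /= in_itv /= -ler_norml.
have z y : slice f y v = 0 by apply: (fB _ (rshift 1 j)); rewrite cons_row_tail.
by rewrite !z subrr normr0 ltW.
Qed.

(** The second estimate is what makes the partial integrals continuous, hence
    integrable, at the next step of the induction. *)
Definition iterated_bounds m := forall (B : R) (f g : 'rV[R]_m -> R),
  0 <= B -> cont_box B f -> cont_box B g ->
  ((forall v, f v <= g v) -> integral_rV f <= integral_rV g) /\
  (forall e, 0 <= e -> (forall v, `|f v - g v| <= e) ->
    `|integral_rV f - integral_rV g| <= e * (B *+ 2) ^+ m).

Section Step.
Variables (m : nat) (B : R).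
Hypotheses (IHm : iterated_bounds m) (B0 : 0 <= B).
Local Notation I := (`[- B, B]%classic : set R).

Let marginal (f : 'rV[R]_m.+1 -> R) (x : R) : R := integral_rV (slice f x).

Lemma marginal_continuous f : cont_box B f -> continuous (marginal f : R -> R^o).
Proof.
move=> fB x0; apply/cvgrPdist_le => e e0.
(* Adding 1 makes the factor invertible even when the box is a point. *)
pose N : R := (B *+ 2) ^+ m + 1.
have N0 : 0 < N by rewrite ltr_wpDl // exprn_ge0 // mulrn_wge0.
have eN : 0 < e / N by rewrite divr_gt0.
apply: filterS (slice_uniform x0 fB eN) => x xP.
have [_ /(_ _ (ltW eN) xP)] :=
  IHm B0 (slice_cont_box x0 fB) (slice_cont_box x fB).
move/le_trans; apply; rewrite mulrAC ler_pdivrMr //.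
by apply: ler_wpM2l; [exact: ltW|rewrite lerDl ler01].
Qed.

Lemma marginal_out f x : cont_box B f -> B < `|x| -> marginal f x = 0.
Proof. by move=> fB xB; rewrite /marginal (slice_out fB xB) integral_rV0. Qed.

Lemma marginal_integrable f : cont_box B f ->
  (@lebesgue_measure R).-integrable I (EFin \o marginal f).
Proof.
move=> fB; apply: continuous_compact_integrable; first exact: segment_compact.
by apply: continuous_subspaceT; exact: marginal_continuous.
Qed.

Lemma integral_marginal f : cont_box B f ->
  integral_rV f = Rintegral (@lebesgue_measure R) I (marginal f).
Proof.
move=> fB; rewrite Rintegral_mkcond /=; congr (Rintegral _ _ _); apply/funext => x.
rewrite patchE; case: ifPn => // xI; apply: (marginal_out fB).
rewrite ltNge; apply/negP => xB; move/negP: xI; apply.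
by rewrite inE /= in_itv /= -ler_norml.
Qed.

Lemma integral_const_box (c : R) :
  Rintegral (@lebesgue_measure R) I (fun=> c) = c * (B *+ 2).
Proof.
rewrite Rintegral_cst //; have := @lebesgue_measure_itv R `[- B, B]; rewrite /= lte_fin => ->.
case: ltP => [_|BB]; first by rewrite -EFinB /= opprK mulr2n.
have -> : B = 0 by apply/eqP; rewrite eq_le B0 andbT; lra.
by rewrite mul0rn.
Qed.

Lemma iterated_bounds_step (f g : 'rV[R]_m.+1 -> R) : cont_box B f -> cont_box B g ->
  ((forall v, f v <= g v) -> integral_rV f <= integral_rV g) /\
  (forall e, 0 <= e -> (forall v, `|f v - g v| <= e) ->
    `|integral_rV f - integral_rV g| <= e * (B *+ 2) ^+ m.+1).
Proof.
move=> fB gB; rewrite !(integral_marginal fB, integral_marginal gB).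
have fi := marginal_integrable fB; have gi := marginal_integrable gB.
split=> [fg|e e0 fg].
  apply: le_Rintegral => // x _.
  apply: (IHm B0 (slice_cont_box x fB) (slice_cont_box x gB)).1 => v; exact: fg.
rewrite -RintegralB //.
have bnd x : `|marginal f x - marginal g x| <= e * (B *+ 2) ^+ m.
  apply: (IHm B0 (slice_cont_box x fB) (slice_cont_box x gB)).2 => // v; exact: fg.
have di : (@lebesgue_measure R).-integrable I (EFin \o (fun x => marginal f x - marginal g x)).
  exact: integrableB fi gi.
have ci (c : R) : (@lebesgue_measure R).-integrable I (EFin \o (fun=> c)).
  apply: continuous_compact_integrable; first exact: segment_compact.
  by apply: continuous_subspaceT => x; exact: cvg_cst.
rewrite exprSr mulrA ler_norml -mulNr -!integral_const_box; apply/andP.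
split; apply: le_Rintegral => // x _; have := bnd x; rewrite ler_norml.
  by case/andP.
by case/andP.
Qed.

End Step.

Lemma integral_rV_bounds m : iterated_bounds m.
Proof.
elim: m => [B f g B0 fB gB|m IHm B f g B0 fB gB]; last exact: iterated_bounds_step.
by split=> [fg|e e0 fg] /=; rewrite ?expr0 ?mulr1.
Qed.

Lemma le_integral_rV m (B : R) (f g : 'rV[R]_m -> R) :
    0 <= B -> cont_box B f -> cont_box B g -> (forall v, f v <= g v) ->
  integral_rV f <= integral_rV g.
Proof. by move=> B0 fB gB; have [] := integral_rV_bounds B0 fB gB. Qed.

End IteratedIntegral.

(** * Chern numbers *)

Section Continuity.
Variables (R : realType) (n : nat) (T : topologicalType).
Local Notation C := R[i].
Local Notation form := (ext C (n + n)).
Implicit Types (f g : T -> C) (w : T -> form) (v : T).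

(** Continuity of complex functions through the real and imaginary parts, which are
    what is integrated. *)
Definition ccont f v :=
  {for v, continuous (fun u => complex.Re (f u) : R^o)} /\
  {for v, continuous (fun u => complex.Im (f u) : R^o)}.

Lemma ccont_cst (c : C) v : ccont (fun=> c) v.
Proof. by split; exact: cvg_cst. Qed.

Lemma ccontD f g v : ccont f v -> ccont g v -> ccont (fun u => f u + g u) v.
Proof.
move=> [f1 f2] [g1 g2]; split.
  rewrite (_ : (fun u => _) = (fun u => complex.Re (f u) + complex.Re (g u) : R^o)).
    exact: (continuousD f1 g1).
  by apply/funext => u; rewrite raddfD.
rewrite (_ : (fun u => _) = (fun u => complex.Im (f u) + complex.Im (g u) : R^o)).
  exact: (continuousD f2 g2).
by apply/funext => u; rewrite raddfD.
Qed.

Lemma ccontM f g v : ccont f v -> ccont g v -> ccont (fun u => f u * g u) v.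
Proof.
move=> [f1 f2] [g1 g2]; split.
  rewrite (_ : (fun u => _) = (fun u => complex.Re (f u) * complex.Re (g u)
      - complex.Im (f u) * complex.Im (g u) : R^o)).
    exact: (continuousB (continuousM f1 g1) (continuousM f2 g2)).
  by apply/funext => u; exact: complex_ReM.
rewrite (_ : (fun u => _) = (fun u => complex.Re (f u) * complex.Im (g u)
    + complex.Im (f u) * complex.Re (g u) : R^o)).
  exact: (continuousD (continuousM f1 g2) (continuousM f2 g1)).
by apply/funext => u; exact: complex_ImM.
Qed.

Lemma ccont_conj f v : ccont f v -> ccont (fun u => (f u)^*%R) v.
Proof.
move=> [f1 f2]; split.
  rewrite (_ : (fun u => _) = (fun u => complex.Re (f u) : R^o)) //.
  by apply/funext => u; case: (f u).
rewrite (_ : (fun u => _) = (fun u => - complex.Im (f u) : R^o)).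
  exact: (continuousN f2).
by apply/funext => u; case: (f u).
Qed.

Lemma ccont_near f g v : {near v, f =1 g} -> ccont f v -> ccont g v.
Proof.
move=> fg [f1 f2]; have fgv : f v = g v := nbhs_singleton fg; split.
  rewrite /prop_for /continuous_at -fgv; apply: cvg_trans f1; apply: near_eq_cvg.
  by apply: filterS fg => u ->.
rewrite /prop_for /continuous_at -fgv; apply: cvg_trans f2; apply: near_eq_cvg.
by apply: filterS fg => u ->.
Qed.

Lemma ccont_sum (I : Type) (r : seq I) (P : pred I) (F : I -> T -> C) v :
  (forall i, ccont (F i) v) -> ccont (fun u => \sum_(i <- r | P i) F i u) v.
Proof.
move=> Fc; elim: r => [|i r IHr].
  rewrite (_ : (fun u => _) = (fun=> 0)); first exact: ccont_cst.
  by apply/funext => u; rewrite big_nil.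
rewrite (_ : (fun u => _) = (fun u => if P i then F i u + \sum_(j <- r | P j) F j u
                else \sum_(j <- r | P j) F j u)).
  case: (P i); last exact: IHr.
  exact: (ccontD (Fc i) IHr).
by apply/funext => u; rewrite big_cons.
Qed.

Definition fcont w v := forall S, ccont (fun u => w u S) v.

Lemma fcont_cst (c : form) v : fcont (fun=> c) v.
Proof. by move=> S; exact: ccont_cst. Qed.

Lemma fcont_sum (I : Type) (r : seq I) (P : pred I) (F : I -> T -> form) v :
  (forall i, fcont (F i) v) -> fcont (fun u => \sum_(i <- r | P i) F i u) v.
Proof.
move=> Fc S; rewrite (_ : (fun u => _) = (fun u => \sum_(i <- r | P i) F i u S)).
  by apply: ccont_sum => i; exact: Fc.
by apply/funext => u; rewrite sum_ffunE.
Qed.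

Lemma fcontM w1 w2 v : fcont w1 v -> fcont w2 v -> fcont (fun u => w1 u * w2 u) v.
Proof.
move=> c1 c2 U; rewrite (_ : (fun u => _) = (fun u =>
    \sum_S \sum_(T' | S :|: T' == U) shuffle_sign C S T' * w1 u S * w2 u T')).
  apply: ccont_sum => S; apply: ccont_sum => S'.
  exact: (ccontM (ccontM (ccont_cst _ _) (c1 S)) (c2 S')).
by apply/funext => u; rewrite ffunE.
Qed.

Lemma fcontZ (c : C) w v : fcont w v -> fcont (fun u => c *: w u) v.
Proof.
move=> wc S; rewrite (_ : (fun u => _) = (fun u => c * w u S)).
  exact: (ccontM (ccont_cst _ _) (wc S)).
by apply/funext => u; rewrite ffunE.
Qed.

Lemma fcont_prod (I : Type) (r : seq I) (F : I -> T -> form) v :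
  (forall i, fcont (F i) v) -> fcont (fun u => \prod_(i <- r) F i u) v.
Proof.
move=> Fc; elim: r => [|i r IHr].
  rewrite (_ : (fun u => _) = (fun=> 1)); first exact: fcont_cst.
  by apply/funext => u; rewrite big_nil.
rewrite (_ : (fun u => _) = (fun u => F i u * \prod_(j <- r) F j u)).
  exact: (fcontM (Fc i) IHr).
by apply/funext => u; rewrite big_cons.
Qed.

Lemma fcont_conj w v : fcont w v -> fcont (fun u => conj_form (w u)) v.
Proof.
move=> wc; rewrite (_ : (fun u => _) = (fun u => \sum_S
    ((w u S)^*%R) *: \prod_(s in S) conj_gen R s)).
  apply: fcont_sum => S U.
  rewrite (_ : (fun u => _) = (fun u => (w u S)^*%R * (\prod_(s in S) conj_gen R s) U)).
    exact: (ccontM (ccont_conj (wc S)) (ccont_cst _ _)).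
  by apply/funext => u; rewrite ffunE.
by apply/funext => u; apply: eq_bigr => S _; rewrite ffunE.
Qed.

Lemma fcont_near w1 w2 v : {near v, w1 =1 w2} -> fcont w1 v -> fcont w2 v.
Proof.
by move=> w12 c1 S; apply: ccont_near (c1 S); apply: filterS w12 => u ->.
Qed.

Lemma fcont_weighted_trace r m p (u : 'S_p -> C) (A : T -> 'M[form]_(r, m)) v :
    (forall a b, fcont (fun t => A t a b) v) ->
  fcont (fun t => weighted_trace u (chern_gram (A t))) v.
Proof.
move=> Ac; apply: fcont_sum => a; apply: fcont_sum => s; apply: fcontZ.
apply: fcontM; first exact: fcont_cst.
apply: fcont_prod => j.
rewrite (_ : (fun t => _) = (fun t => ('i / (2%:R * pi%:C)) *: \sum_l
    A t (a j) l * conj_form (A t (a (s j)) l))).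
  apply: fcontZ; apply: fcont_sum => l.
  exact: (fcontM (Ac _ _) (fcont_conj (Ac _ _))).
by apply/funext => t; rewrite !mxE; congr (_ *: _); apply: eq_bigr => l _; rewrite !mxE.
Qed.

End Continuity.

Section BottChern.
Variables (R : realType) (n : nat) (M : topologicalType).
Variables (X : complex_manifold R n M) (r : nat) (E : holo_bundle X r).
Variable h : hermitian_metric E.
Hypothesis h_ge0 : bott_chern_nonneg h.
Local Notation C := R[i].
Local Notation V := 'rV[R]_(n + n).
Local Notation form := (ext C (n + n)).

(** The Chern forms are defined at each point through a trivialization chosen there;
    around x they are given by one smooth matrix A. *)
Lemma chern_form_gram x : exists (W : set M) (m : nat) (A : chart X -> V -> 'M[form]_(r, m)),
  [/\ open W, W x,
      forall i v a b, (phi i @` (W `&` cdom i)) v -> fcont (fun u => A i u a b) v,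
      forall i v a b, (phi i @` (W `&` cdom i)) v -> bidegree 1 0 (A i v a b) &
      forall i v, (phi i @` (W `&` cdom i)) v ->
        forall p, chern_form h p i v = chern_coef (evenize (chern_gram (A i v))) p].
Proof.
have [W [e [m [A [openW Wx e_unit A_smooth curvE]]]]] := h_ge0 x.
exists W, m, A; split=> //.
- move=> i v a b Wv S; have [As _ _] := A_smooth a b.
  have [AR AI] := As i S.
  by split; [exact: (AR 0%N).1|exact: (AI 0%N).1].
- by move=> i _ a b [y [Wy iy] <-]; have [_ A10 _] := A_smooth a b; exact: A10.
move=> i _ [y [Wy iy] <-] p.
have Wy' : W (psi i (phi i y)) by rewrite phiK.
have iv : (phi i @` cdom i) (phi i y) by exists y.
apply: (chern_form_unitary p openW Wy' iv e_unit _ (curvE i y Wy iy)) => a b.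
by have [_ A10 _] := A_smooth a b; exact: A10.
Qed.

Lemma chern_inequalities (i : chart X) x (l : seq nat) : cdom i x ->
  [/\ strongly_nonneg (sumn l) (chern_monomial h l i (phi i x)),
      strongly_nonneg (sumn l) (chern_form h (sumn l) i (phi i x)),
      strongly_nonneg (sumn l)
        (chern_monomial h l i (phi i x) - chern_form h (sumn l) i (phi i x)) &
      strongly_nonneg (sumn l)
        (chern_form h 1 i (phi i x) ^+ sumn l - chern_monomial h l i (phi i x))].
Proof.
move=> ix; have [W [m [A [openW Wx _ A10 chernE]]]] := chern_form_gram x.
have Wv : (phi i @` (W `&` cdom i)) (phi i x) by exists x.
have {}A10 a b : bidegree 1 0 (A i (phi i x) a b) by exact: A10.
set K := evenize (chern_gram (A i (phi i x))).
have KE : map_mx val K = chern_gram (A i (phi i x)) := evenizeK (chern_gram_even A10).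
have monoE : chern_monomial h l i (phi i x) = \prod_(p <- l) chern_coef K p.
  by apply: eq_bigr => p _; exact: chernE.
rewrite monoE !(chernE i _ Wv); split.
- exact: (strongly_nonneg_chern_monomial A10 KE).
- exact: (strongly_nonneg_chern_coef A10 KE).
- exact: (chern_coef_le_monomial A10 KE).
- exact: (chern_monomial_le_chern1X A10 KE).
Qed.

Lemma chern_form_continuous (i : chart X) v p : (phi i @` cdom i) v ->
  fcont (chern_form h p i) v.
Proof.
move=> [x ix <-]; have [W [m [A [openW Wx Ac A10 chernE]]]] := chern_form_gram x.
have Wv : (phi i @` (W `&` cdom i)) (phi i x) by exists x.
have cA a b : fcont (fun u => A i u a b) (phi i x) by exact: Ac.
apply: fcont_near (fcont_weighted_trace (avg C [set: 'S_p]%G) cA).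
have openO := @chart_image_open R n M X i W openW.
apply: filterS (open_nbhs_nbhs (conj openO Wv)) => u Wu.
have A10u a b : bidegree 1 0 (A i u a b) by exact: A10.
by rewrite (chernE i u Wu) chern_coef_trace (evenizeK (chern_gram_even A10u)).
Qed.

End BottChern.

Section Integration.
Variables (R : realType) (n : nat) (M : topologicalType) (X : complex_manifold R n M).
Hypothesis M_compact : compact [set: M].
Variable P : partition_of_unity X.
Local Notation C := R[i].
Local Notation V := 'rV[R]_(n + n).
Local Notation form := (ext C (n + n)).

Definition integrand (k : 'I_(pu_size P)) (w : local_forms X) (v : V) : C :=
  if v \in phi (pu_chart k) @` cdom (pu_chart k)
  then (pu_fun k (psi (pu_chart k) v))%:C * density (w (pu_chart k) v) else 0.

(** Each coordinate is bounded on K; the sum of the bounds serves for all. *)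
Lemma compact_coord_bounded (K : set V) : compact K ->
  exists2 B : R, 0 <= B & forall v j, K v -> `|v ord0 j| <= B.
Proof.
move=> cK.
have coord_bound (j : 'I_(n + n)) : exists2 B : R, 0 <= B & forall v, K v -> `|v ord0 j| <= B.
  have cj : compact ((fun v : V => v ord0 j : R^o) @` K).
    apply: continuous_compact cK; apply: continuous_subspaceT => v.
    exact: coord_continuous.
  have [B [_ BP]] := compact_bounded cj.
  exists (`|B| + 1) => [|v Kv]; first by rewrite addr_ge0.
  by apply: (BP (`|B| + 1)); [rewrite ltr_pwDr // ler_norm|exists v].
have [f fP] := choice (fun j => let: ex_intro2 B B0 BP := coord_bound j in
  ex_intro (fun B => 0 <= B /\ forall v, K v -> `|v ord0 j| <= B) B (conj B0 BP)).
exists (\sum_j f j) => [|v j Kv]; first by apply: sumr_ge0 => j _; exact: (fP j).1.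
apply: (le_trans ((fP j).2 v Kv)); rewrite (bigD1 j) //= lerDl.
by apply: sumr_ge0 => l _; exact: (fP l).1.
Qed.

(** The support of the function of the partition is compact and lies in the domain
    of the chart, so the extension by zero outside the chart is continuous. The
    bound on the support does not depend on the form w. *)
Lemma integrand_cont_box (k : 'I_(pu_size P)) : exists2 B : R, 0 <= B &
  forall w : local_forms X,
    (forall v, (phi (pu_chart k) @` cdom (pu_chart k)) v -> fcont (w (pu_chart k)) v) ->
  cont_box B (fun v => complex.Re (integrand k w v)).
Proof.
set i := pu_chart k; pose Z := closure [set x | pu_fun k x != 0].
have Zi : Z `<=` cdom i := pu_support (p := P) (k := k).
have cZ : compact Z.
  by apply: (subclosed_compact _ M_compact) => //; exact: closed_closure.
have cphiZ : compact (phi i @` Z).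
  apply: continuous_compact cZ; apply/continuous_in_subspaceT => x xZ.
  by apply: phi_continuous; apply: Zi; exact: set_mem.
have out v : ~ (phi i @` Z) v -> forall w, integrand k w v = 0.
  move=> vZ w; rewrite /integrand -/i; case: ifPn => // /set_mem[x ix xv].
  have [|nz] := eqVneq (pu_fun k x) 0.
    by move=> p0; rewrite -xv phiK // p0 mul0r.
  by case: vZ; exists x => //; apply: subset_closure.
have [B B0 BP] := compact_coord_bounded cphiZ.
exists B => // w wc; split=> [v|v j vj]; last first.
  have vZ : ~ (phi i @` Z) v by move=> /(BP v j); rewrite leNgt vj.
  by rewrite (out v vZ w).
have [vi|nvi] := pselect ((phi i @` cdom i) v).
  have : ccont (fun u => (pu_fun k (psi i u))%:C * density (w i u)) v.
    apply: ccontM.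
      have c0 := (ccont_cst (0 : C) v).2.
      by split; [exact: ((pu_smooth k i) 0%N).1 v vi|exact: c0].
    exact: (ccontM (wc v vi _) (ccont_cst _ _)).
  move=> /(@ccont_near _ _ _ (integrand k w)) [].
    have openi : open (phi i @` cdom i) := @phi_open R n M X i.
    apply: filterS (open_nbhs_nbhs (conj openi vi)) => u ui.
    by rewrite /integrand -/i mem_set.
  by [].
have oZ : open (~` (phi i @` Z)).
  by apply: closed_openC; apply: compact_closed cphiZ; exact: norm_hausdorff.
have vZ : (~` (phi i @` Z)) v by move=> [x Zx xv]; apply: nvi; exists x => //; exact: Zi.
have : ccont (fun=> 0 : C) v by exact: ccont_cst.
move=> /(@ccont_near _ _ _ (integrand k w)) [] //.
apply: filterS (open_nbhs_nbhs (conj oZ vZ)) => u uZ.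
by rewrite (out u uZ w).
Qed.

(** The densities are real and ordered, so only the real parts of the integrals
    matter, and these are integrals of continuous functions with support in a
    common box. *)
Lemma integral_form_ge0_le (w1 w2 : local_forms X) :
    (forall (i : chart X) v, (phi i @` cdom i) v -> fcont (w1 i) v) ->
    (forall (i : chart X) v, (phi i @` cdom i) v -> fcont (w2 i) v) ->
    le_strong n (fun _ _ => 0) w1 -> le_strong n w1 w2 ->
  0 <= integral_form P w1 /\ integral_form P w1 <= integral_form P w2.
Proof.
move=> c1 c2 w1_ge0 w12.
have d1 (i : chart X) v : (phi i @` cdom i) v -> 0 <= density (w1 i v).
  by move=> [x ix <-]; apply: density_ge0; rewrite -[w1 _ _]subr0; exact: w1_ge0.
have d12 (i : chart X) v : (phi i @` cdom i) v -> density (w1 i v) <= density (w2 i v).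
  move=> [x ix <-]; rewrite -subr_ge0.
  by have := density_ge0 (w12 i x ix); rewrite /density !ffunE mulrBl.
have ReIm (k : 'I_(pu_size P)) v : [/\ 0 <= integrand k w1 v & integrand k w1 v <= integrand k w2 v].
  rewrite /integrand; case: ifPn => [/set_mem vi|_]; last by split.
  have p0 : 0 <= (pu_fun k (psi (pu_chart k) v))%:C by rewrite lecR pu_ge0.
  by split; [apply: mulr_ge0 => //; exact: d1|apply: ler_wpM2l => //; exact: d12].
have Im1 (k : 'I_(pu_size P)) v : complex.Im (integrand k w1 v) = 0.
  by have [+ _] := ReIm k v; rewrite lecE => /andP[/eqP].
have Im2 (k : 'I_(pu_size P)) v : complex.Im (integrand k w2 v) = 0.
  by have [_] := ReIm k v; rewrite lecE Im1 => /andP[/eqP].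
have Re1 (k : 'I_(pu_size P)) v : 0 <= complex.Re (integrand k w1 v).
  by have [+ _] := ReIm k v; rewrite lecE => /andP[_].
have Re12 (k : 'I_(pu_size P)) v :
    complex.Re (integrand k w1 v) <= complex.Re (integrand k w2 v).
  by have [_] := ReIm k v; rewrite lecE => /andP[_].
have termE (w : local_forms X) : integral_form P w = \sum_(k < pu_size P)
    (integral_rV (fun v => complex.Re (integrand k w v))
     +i* integral_rV (fun v => complex.Im (integrand k w v))) by [].
have term1 k : integral_rV (fun v => complex.Im (integrand k w1 v)) = 0.
  by rewrite (funext (Im1 k)) integral_rV0.
have term2 k : integral_rV (fun v => complex.Im (integrand k w2 v)) = 0.
  by rewrite (funext (Im2 k)) integral_rV0.
rewrite !termE; split.
  apply: sumr_ge0 => k _; rewrite term1 lecE /= eqxx /=.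
  have [B B0 BP] := integrand_cont_box k.
  have z0 : cont_box B (fun _ : V => 0 : R) by split=> // v; exact: (ccont_cst (0 : C) v).1.
  rewrite -[leLHS](integral_rV0 R (n + n)).
  exact: (le_integral_rV B0 z0 (BP _ (c1 (pu_chart k)))).
apply: ler_sum => k _; rewrite term1 term2 lecE /= eqxx /=.
have [B B0 BP] := integrand_cont_box k.
exact: (le_integral_rV B0 (BP _ (c1 (pu_chart k))) (BP _ (c2 (pu_chart k)))).
Qed.

End Integration.

Local Close Scope complex_scope.

Theorem theorem3p2 (R : realType) (n r : nat) (M : topologicalType)
    (X : complex_manifold R n M) (E : holo_bundle X r) (h : hermitian_metric E)
    (M_compact : compact [set: M]) (h_ge0 : bott_chern_nonneg h) :
  (forall (p : nat) (lam : seq nat), (1 <= p <= n)%N -> Gamma p r lam ->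
    [/\ le_strong p (fun _ _ => 0) (chern_monomial h lam),
        le_strong p (fun _ _ => 0) (chern_form h p),
        le_strong p (chern_form h p) (chern_monomial h lam) &
        le_strong p (chern_monomial h lam)
          (fun i v => chern_form h 1 i v ^+ p)]) /\
  (forall (P : partition_of_unity X) (lam : seq nat), Gamma n r lam ->
    [/\ 0 <= integral_form P (chern_form h n),
        integral_form P (chern_form h n) <= chern_number h P lam &
        chern_number h P lam
          <= integral_form P (fun i v => chern_form h 1 i v ^+ n)]).
Proof.
have le0 p (w : local_forms X) : (forall (i : chart X) x, cdom i x ->
    strongly_nonneg p (w i (phi i x))) -> le_strong p (fun _ _ => 0) w.
  by move=> w0 i x ix; rewrite subr0; exact: w0.
have pointwise p lam : Gamma p r lam ->
    [/\ le_strong p (fun _ _ => 0) (chern_monomial h lam),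
        le_strong p (fun _ _ => 0) (chern_form h p),
        le_strong p (chern_form h p) (chern_monomial h lam) &
        le_strong p (chern_monomial h lam) (fun i v => chern_form h 1 i v ^+ p)].
  move=> [_ _ _ <-]; split; [apply: le0|apply: le0| |] => i x ix;
    by have [] := chern_inequalities h_ge0 lam ix.
split=> [p lam _|P lam Glam]; first exact: pointwise.
have [mono_ge0 cn_ge0 cn_le mono_le] := pointwise n lam Glam.
have cn_cont (i : chart X) v p : (phi i @` cdom i) v -> fcont (chern_form h p i) v.
  exact: chern_form_continuous.
have mono_cont (i : chart X) v : (phi i @` cdom i) v -> fcont (chern_monomial h lam i) v.
  by move=> iv; apply: fcont_prod => p; exact: cn_cont.
have pow_cont (i : chart X) v : (phi i @` cdom i) v ->
    fcont (fun u => chern_form h 1 i u ^+ n) v.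
  move=> iv; rewrite (_ : (fun u => _) = (fun u => \prod_(p <- nseq n 1%N) chern_form h p i u)).
    by apply: fcont_prod => p; exact: cn_cont.
  by apply/funext => u; rewrite big_nseq iter_mulr_1.
have [i0 i1] := integral_form_ge0_le M_compact P (fun i v => @cn_cont i v n) mono_cont cn_ge0 cn_le.
have [_ i2] := integral_form_ge0_le M_compact P mono_cont pow_cont mono_ge0 mono_le.
by split.
Qed.
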